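(* Let $\eta\in C^2(\mathbb{R}^n)\cap L^2(\mathbb{R}^n,\gamma_n)$ be even (and such that the integrals below are well defined). Then (i) $$\frac12\int_{\mathbb{R}^n}\left(\triangle\eta-\langle\nabla\eta,x\rangle\right)^2d\gamma_n\ \le\ \int_{\mathbb{R}^n}\|\mathrm{Hess}\,\eta\|_{HS}^2\,d\gamma_n.$$ (ii) $$\int_{\mathbb{R}^n}\|\nabla\eta\|^2d\gamma_n-\frac14\int_{\mathbb{R}^n}\left(\triangle\eta-\langle\nabla\eta,x\rangle\right)^2d\gamma_n\ \le\ \mathrm{Var}_{\gamma_n}(\eta)$$ and $$\mathrm{Var}_{\gamma_n}(\eta)\ \le\ \int_{\mathbb{R}^n}\|\nabla\eta\|^2d\gamma_n-\frac12\int_{\mathbb{R}^n}\left(\triangle\eta-\langle\nabla\eta,x\rangle\right)^2d\gamma_n+\frac12\int_{\mathbb{R}^n}\|\mathrm{Hess}\,\eta\|_{HS}^2\,d\gamma_n.$$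
   Context: $\gamma_n$ is the normalized (standard) Gaussian probability measure on $\mathbb{R}^n$, $d\gamma_n=(2\pi)^{-n/2}e^{-\|x\|^2/2}dx$. $\|\cdot\|_{HS}$ is the Hilbert–Schmidt norm of a matrix, $\mathrm{Hess}\,\eta$ the Hessian, $\triangle\eta=\mathrm{tr}(\mathrm{Hess}\,\eta)$ the Laplacian, and $\mathrm{Var}_{\gamma_n}(\eta)=\int\eta^2d\gamma_n-\left(\int\eta\,d\gamma_n\right)^2$. Standing assumption: $\eta$ satisfies the integrability conditions needed for the expressions to make sense (i.e. $\|\nabla\eta\|$, $\|\mathrm{Hess}\,\eta\|_{HS}$ and $\triangle\eta-\langle\nabla\eta,x\rangle$ are in $L^2(\gamma_n)$). *)

(* Defs.v *)
From HB Require Import structures.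
From mathcomp Require Import all_boot all_order all_algebra.
From mathcomp Require Import all_classical all_reals all_analysis.
From mathcomp Require Import measurable_realfun ring.

Set Implicit Arguments.
Unset Strict Implicit.
Unset Printing Implicit Defensive.
Import Order.TTheory GRing.Theory Num.Theory.
Import numFieldNormedType.Exports.

Local Open Scope classical_set_scope.
Local Open Scope ring_scope.

(* 'rV[R]_n carries the sigma-algebra generated by its n coordinate maps, that
   is, the Borel sigma-algebra of R^n. *)
Definition measure_rV_display : measure_display.
Proof. exact: default_measure_display. Qed.

Section measurable_rV.
Variables (R : realType) (n : nat).

Definition rV_coord (i : 'I_n) (x : 'rV[R]_n) : measurableTypeR R := x ord0 i.

Let rV_set0 : g_sigma_preimage rV_coord set0.
Proof. exact: sigma_algebra0. Qed.

Let rV_setC A : g_sigma_preimage rV_coord A ->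
  g_sigma_preimage rV_coord (~` A).
Proof. exact: sigma_algebraC. Qed.

Let rV_bigcup (F : _^nat) : (forall i, g_sigma_preimage rV_coord (F i)) ->
  g_sigma_preimage rV_coord (\bigcup_i (F i)).
Proof. exact: sigma_algebra_bigcup. Qed.

HB.instance Definition _ := @isMeasurable.Build measure_rV_display
  'rV[R]_n (g_sigma_preimage rV_coord) rV_set0 rV_setC rV_bigcup.

End measurable_rV.

Section measurable_fun_rV.
Variables (R : realType) (n : nat).

Lemma measurable_rV_coord (i : 'I_n) :
  measurable_fun [set: 'rV[R]_n] (fun x : 'rV[R]_n => x ord0 i).
Proof.
move=> _ Y mY; rewrite setTI; apply: sub_sigma_algebra => /=.
rewrite -bigcup_seq/=; exists i => /=; first by rewrite mem_index_enum.
by exists Y => //; rewrite setTI.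
Qed.

Lemma measurable_fun_rVP d (T : measurableType d) (f : T -> 'rV[R]_n) :
  measurable_fun [set: T] f <->
  forall i, measurable_fun [set: T] (fun x => f x ord0 i).
Proof.
split=> [mf i|mf].
  exact: (measurableT_comp (measurable_rV_coord i) mf).
suff: g_sigma_preimage (fun i => @rV_coord R n i \o f) `<=` measurable.
  rewrite g_sigma_preimage_comp => prefS _ A mA.
  by apply: prefS; exists A.
apply: smallest_sub; first exact: sigma_algebra_measurable.
case: n f mf => [|m] f mf; first by rewrite big_ord0.
rewrite -bigcup_mkord_ord; apply: bigcup_sub => i Ii.
by move=> A [B mB <-]; exact: mf.
Qed.

End measurable_fun_rV.

Section lebesgue_measure_rV.
Variable R : realType.
Local Open Scope ereal_scope.

Definition rV_cons n (p : measurableTypeR R * 'rV[R]_n) : 'rV[R]_n.+1 :=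
  row_mx (p.1 : R)%:M p.2.

Lemma rV_consE0 n (p : measurableTypeR R * 'rV[R]_n) : rV_cons p ord0 ord0 = p.1.
Proof.
rewrite /rV_cons (_ : ord0 = lshift n ord0 :> 'I_(1 + n)); last exact: val_inj.
by apply: (etrans (row_mxEl _ _ _ _)); rewrite mxE eqxx mulr1n.
Qed.

Lemma rV_consES n (p : measurableTypeR R * 'rV[R]_n) (i : 'I_n) :
  rV_cons p ord0 (lift ord0 i) = p.2 ord0 i.
Proof.
rewrite /rV_cons (_ : lift ord0 i = rshift 1 i :> 'I_(1 + n)).
  exact: row_mxEr.
exact: val_inj.
Qed.

Lemma measurable_rV_cons n : measurable_fun setT (@rV_cons n).
Proof.
apply/measurable_fun_rVP => i; have [j ->|->] := unliftP ord0 i.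
  under eq_fun do rewrite rV_consES.
  exact: (measurableT_comp (measurable_rV_coord j) measurable_snd).
under eq_fun do rewrite rV_consE0.
exact: measurable_fst.
Qed.

Section step.
Variables (n : nat) (mu : {sigma_finite_measure set 'rV[R]_n -> \bar R}).

Definition lebesgue_rV_step : set 'rV[R]_n.+1 -> \bar R :=
  pushforward (@lebesgue_measure R \x mu) (@rV_cons n).

Let step0 : lebesgue_rV_step set0 = 0.
Proof. by rewrite /lebesgue_rV_step /pushforward preimage_set0 measure0. Qed.

Let step_ge0 A : 0 <= lebesgue_rV_step A.
Proof. by rewrite /lebesgue_rV_step /pushforward; exact: measure_ge0. Qed.

Let step_sigma_additive : semi_sigma_additive lebesgue_rV_step.
Proof.
move=> F mF tF mUF; rewrite /lebesgue_rV_step /pushforward preimage_bigcup.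
have mcons A : measurable A -> measurable (@rV_cons n @^-1` A).
  by move=> mA; rewrite -[X in measurable X]setTI; exact: measurable_rV_cons.
apply: measure_semi_sigma_additive.
- by move=> k; exact: mcons.
- apply/trivIsetP => /= i j _ _ ij; rewrite -preimage_setI.
  by move/trivIsetP : tF => /(_ _ _ _ _ ij) ->//; rewrite preimage_set0.
- by rewrite -preimage_bigcup; exact: mcons.
Qed.

HB.instance Definition _ := isMeasure.Build _ _ _ lebesgue_rV_step
  step0 step_ge0 step_sigma_additive.

Let uncons (x : 'rV[R]_n.+1) : measurableTypeR R * 'rV[R]_n :=
  (x ord0 ord0, \row_i x ord0 (lift ord0 i)).

Let muncons : measurable_fun setT uncons.
Proof.
apply/measurable_fun_pairP; split; first exact: measurable_rV_coord.
apply/measurable_fun_rVP => i /=.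
under eq_fun do rewrite mxE.
exact: measurable_rV_coord.
Qed.

Let consK : cancel (@rV_cons n) uncons.
Proof.
move=> [a v]; rewrite /uncons rV_consE0/=; congr pair.
by apply/rowP => i; rewrite mxE rV_consES.
Qed.

Let step_sigma_finite : sigma_finite setT lebesgue_rV_step.
Proof.
have /sigma_finiteP[F [TF ndF Foo]] := sigma_finiteT (@lebesgue_measure R).
have /sigma_finiteP[G [TG ndG Goo]] := sigma_finiteT mu.
exists (fun k => uncons @^-1` (F k `*` G k)).
  rewrite -preimage_bigcup -[LHS](preimage_setT uncons); congr (_ @^-1` _).
  rewrite -setXTT TF TG predeqE => -[x y]; split.
    move=> [/= [i _ Fix] [k _ Gky]]; exists (maxn i k) => //; split.
    - by move: x Fix; exact/subsetPset/ndF/leq_maxl.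
    - by move: y Gky; exact/subsetPset/ndG/leq_maxr.
  by move=> [i _ []/= ? ?]; split; exists i.
move=> k; have [mF Fk] := Foo k; have [mG Gk] := Goo k; split.
  by rewrite -[X in measurable X]setTI; apply: muncons => //; exact: measurableX.
rewrite /lebesgue_rV_step /pushforward.
have -> : @rV_cons n @^-1` (uncons @^-1` (F k `*` G k)) = F k `*` G k.
  by rewrite predeqE => p; rewrite -[X in _ <-> _ X]consK.
by rewrite product_measure1E// lte_mul_pinfty// ge0_fin_numE.
Qed.

HB.instance Definition _ := Measure_isSigmaFinite.Build _ _ _ lebesgue_rV_step
  step_sigma_finite.

End step.

(* Lebesgue measure on R^n: the n-fold product of Lebesgue measure on R, and
   the unit mass on the one-point space R^0. *)
Fixpoint lebesgue_rV n : {sigma_finite_measure set 'rV[R]_n -> \bar R} :=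
  match n with
  | 0 => @dirac _ 'rV[R]_0 0%R R
  | m.+1 => lebesgue_rV_step (lebesgue_rV m)
  end.

Lemma ge0_integral_lebesgue_rVS n (f : 'rV[R]_n.+1 -> \bar R) :
  measurable_fun setT f -> (forall x, 0 <= f x) ->
  \int[lebesgue_rV n.+1]_x f x =
  \int[@lebesgue_measure R]_a \int[lebesgue_rV n]_v f (rV_cons (a, v)).
Proof.
move=> mf f0.
pose m1 := @lebesgue_measure R : {sigma_finite_measure set _ -> \bar R}.
pose pm := (m1 \x lebesgue_rV n)%E : {measure set _ -> \bar R}.
have -> := ge0_integral_pushforward (measurable_rV_cons (n:=n)) pm
  measurableT mf (fun x _ => f0 x).
rewrite preimage_setT.
rewrite (fubini_tonelli1 (m1 := m1) (m2 := lebesgue_rV n)) => [||x].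
- by [].
- by apply: measurableT_comp => //; exact: measurable_rV_cons.
- exact: f0.
Qed.

End lebesgue_measure_rV.

Section euclidean.
Variables (R : realType) (n : nat).
Implicit Types u v : 'rV[R]_n.

(* `|v| on 'rV[R]_n is the sup norm, hence the explicit Euclidean structure. *)
Definition dot u v : R := \sum_(i < n) u ord0 i * v ord0 i.

Lemma dot_ge0 v : 0 <= dot v v.
Proof. by apply: sumr_ge0 => i _; rewrite -expr2 sqr_ge0. Qed.

Definition enorm v : R := Num.sqrt (dot v v).

Definition hs_norm (A : 'M[R]_n) : R :=
  Num.sqrt (\sum_(i < n) \sum_(j < n) A i j ^+ 2).

End euclidean.

Section gauss.
Variables (R : realType) (n : nat).
Local Open Scope ereal_scope.

Definition gauss_pdf (x : 'rV[R]_n) : R :=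
  ((2 * pi) `^ (- (n%:R / 2)) * expR (- (enorm x ^+ 2 / 2)))%R.

Definition gauss (A : set 'rV[R]_n) : \bar R :=
  \int[lebesgue_rV R n]_(x in A) (gauss_pdf x)%:E.

Lemma gauss_pdf_ge0 x : (0 <= gauss_pdf x)%R.
Proof. by rewrite mulr_ge0 ?powR_ge0 ?expR_ge0. Qed.

Lemma measurable_gauss_pdf : measurable_fun setT gauss_pdf.
Proof.
apply: measurable_funM; first exact: measurable_cst.
apply: measurableT_comp => //; apply: measurableT_comp => //.
apply: measurable_funM => //; apply: measurable_funX.
apply: measurableT_comp.
  exact: (continuous_measurable_fun (@sqrt_continuous R)).
apply: measurable_sum => i.
by apply: measurable_funM; exact: measurable_rV_coord.
Qed.

Let gauss0 : gauss set0 = 0.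
Proof. exact: integral_set0. Qed.

Let gauss_ge0 A : 0 <= gauss A.
Proof. by apply: integral_ge0 => x _; rewrite lee_fin gauss_pdf_ge0. Qed.

Let gauss_sigma_additive : semi_sigma_additive gauss.
Proof.
move=> /= A mA tA mUA; rewrite /gauss ge0_integral_bigcup//=.
- by apply: is_cvg_ereal_nneg_natsum_cond => k _ _; exact: gauss_ge0.
- apply: measurable_funTS; apply/measurable_EFinP.
  exact: measurable_gauss_pdf.
- by move=> x _; rewrite lee_fin gauss_pdf_ge0.
Qed.

HB.instance Definition _ := isMeasure.Build _ _ _ gauss
  gauss0 gauss_ge0 gauss_sigma_additive.

End gauss.
Arguments gauss R n A : clear implicits.

Section gauss_probability.
Variable R : realType.
Local Open Scope ereal_scope.

Lemma gauss_pdf_cons n (a : R) (v : 'rV[R]_n) :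
  gauss_pdf (rV_cons (a, v)) = (normal_pdf 0 1 a * gauss_pdf v)%R.
Proof.
have dotE : dot (rV_cons (a, v)) (rV_cons (a, v)) = (a ^+ 2 + dot v v)%R.
  rewrite /dot big_ord_recl rV_consE0/= -expr2; congr (_ + _)%R.
  by apply: eq_bigr => i _; rewrite rV_consES.
rewrite normal_pdfE ?oner_eq0// /normal_peak /normal_fun /gauss_pdf.
rewrite /enorm !sqr_sqrtr ?dot_ge0// dotE expr1n mul1r subr0.
have p2 : (0 < 2 * pi :> R)%R by rewrite mulr_gt0// pi_gt0.
have -> : (- (n.+1%:R / 2) = - (2^-1) + - (n%:R / 2) :> R)%R.
  by rewrite -natr1; field.
rewrite powRD; last by apply/implyP => _; rewrite gt_eqF.
rewrite powRN powR12_sqrt ?ltW//.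
have -> : (- ((a ^+ 2 + dot v v) / 2) = - a ^+ 2 / 2 + - (dot v v / 2))%R.
  by field.
by rewrite expRD -[(pi *+ 2)%R]mulr_natl; ring.
Qed.

Lemma gauss_setT n : gauss R n setT = 1.
Proof.
rewrite /gauss; elim: n => [|n IH].
  rewrite /= integral_dirac//; last first.
    by apply/measurable_EFinP; exact: measurable_gauss_pdf.
  rewrite diracT mul1e /gauss_pdf mul0r oppr0 powRr0 mul1r /enorm /dot big_ord0.
  by rewrite sqrtr0 expr0n/= mul0r oppr0 expR0.
rewrite ge0_integral_lebesgue_rVS; first last.
- by move=> x; rewrite lee_fin gauss_pdf_ge0.
- by apply/measurable_EFinP; exact: measurable_gauss_pdf.
under eq_integral => a _.
  under eq_integral do rewrite gauss_pdf_cons EFinM.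
  rewrite ge0_integralZl//; first last.
  - by rewrite lee_fin normal_pdf_ge0.
  - by move=> v _; rewrite lee_fin gauss_pdf_ge0.
  - by apply/measurable_EFinP; exact: measurable_gauss_pdf.
  rewrite IH mule1.
  over.
exact: integral_normal_pdf.
Qed.

HB.instance Definition _ n :=
  Measure_isProbability.Build _ _ _ (gauss R n) (gauss_setT n).

End gauss_probability.

Section calculus.
Variables (R : realType) (n : nat).
Implicit Types f : 'rV[R]_n -> R.

Definition partial (i : 'I_n) f : 'rV[R]_n -> R := 'D_(delta_mx ord0 i) f.

(* Ck k f: f is of class C^k.  Frechet differentiability and C^k partial
   derivatives amount to a Frechet derivative of class C^k, the codomain of
   which is finite-dimensional. *)
Fixpoint Ck k f : Prop :=
  match k with
  | 0 => continuous f
  | k'.+1 => (forall x, differentiable f x) /\ forall i, Ck k' (partial i f)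
  end.

Definition grad f x : 'rV[R]_n := \row_i partial i f x.

Definition hess f x : 'M[R]_n := \matrix_(i, j) partial i (partial j f) x.

Definition laplacian f x : R := \tr (hess f x).

End calculus.

Section variance.
Variables (R : realType) (n : nat).

Definition gauss_var (f : 'rV[R]_n -> R) : R :=
  \int[gauss R n]_x f x ^+ 2 - (\int[gauss R n]_x f x) ^+ 2.

End variance.

(* Main.v *)
Require Import Defs.
From HB Require Import structures.
From mathcomp Require Import all_boot all_order all_algebra.
From mathcomp Require Import all_classical all_reals all_analysis.
From mathcomp Require Import measurable_realfun ring lra.
Import Order.TTheory GRing.Theory Num.Theory.
Import numFieldNormedType.Exports.
Local Open Scope classical_set_scope.
Local Open Scope ring_scope.
Set Implicit Arguments.
Unset Strict Implicit.
Unset Printing Implicit Defensive.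

(** Write L eta = laplacian eta - dot (grad eta) x for the Ornstein-Uhlenbeck
    operator, and A, HS, G, Var for the integrals of (L eta)^2, of the squared
    norm of the Hessian and of the squared norm of the gradient, and for the
    variance. The three inequalities are linear combinations of four relations.

    - 0 <= A - 4 G + 4 Var, for every eta. If m is the mean of eta, then
      integration by parts ([gauss_ibp]) turns the integral of
      (eta - m) * L eta into - G, so that the right-hand side is the integral
      of the square of L eta + 2 (eta - m). This is the lower bound on Var.

    - A <= HS + G, for every eta: Bochner's formula. For the Gaussian
      divergence W of a vector field u with Jacobian matrix H, the integral of
      W^2 is that of tr (H^2) + |u|^2 ([gauss_div_sqr]), and the trace
      is at most |H|^2; take u = grad eta. As eta is only of class C^2, W is merely
      continuous; its derivative, over which one would integrate by parts, is
      replaced by difference quotients, which translations move from W to u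
      ([gauss_div_ibp]). This is done after multiplication by a cutoff, which
      is removed by dominated convergence.

    - G <= HS for even eta: the partial derivatives of eta are odd, and the
      Poincare inequality, that the mean square of an odd function is at most
      that of its gradient ([poincare_odd]), applies to each of them. It is
      proved by induction on the dimension, from the inequality on the line for
      functions that vanish at 0.

    - Var <= G / 2 for even eta. Twice the variance is the mean square of
      eta x - eta y for independent x and y. Rotating the pair (x, y) by 45
      degrees makes this difference an odd function of either new variable, and
      the sum of the inequality for odd functions in both of them gives the
      claim ([poincare_even]).

    The last three give A <= HS + G <= 2 HS and
    Var <= G / 2 <= G - A / 2 + HS / 2. *)

(** * Densities and affine changes of variables *)

Section density.
Local Open Scope ereal_scope.
Context d (T : measurableType d) (R : realType).
Variables (mu nu : {measure set T -> \bar R}) (h : T -> R).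
Hypothesis mh : measurable_fun setT h.
Hypothesis h0 : forall x, (0 <= h x)%R.
Hypothesis nuE : forall A, measurable A -> nu A = \int[mu]_(x in A) (h x)%:E.
Import HBNNSimple.

(** Both sides are limits of their values on the simple functions that
    approximate f from below; on indicators this is the hypothesis on nu. *)
Lemma ge0_integral_density (f : T -> \bar R) : measurable_fun setT f ->
  (forall x, 0 <= f x) -> \int[nu]_x f x = \int[mu]_x (f x * (h x)%:E).
Proof.
move=> mf f0; pose f_ := nnsfun_approx measurableT mf.
have mhE : measurable_fun setT (EFin \o h) by exact/measurable_EFinP.
have cf x : (EFin \o f_^~ x) @ \oo --> f x by exact: cvg_nnsfun_approx.
transitivity (limn (fun n => \int[nu]_x (f_ n x)%:E)).
  rewrite -monotone_convergence//.
  - by apply: eq_integral => y _; apply/esym/cvg_lim => //; exact: cf.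
  - by move=> n; exact/measurable_EFinP/measurable_funP.
  - by move=> n y _; rewrite lee_fin.
  - by move=> y _ m n mn; rewrite lee_fin; exact/lefP/nd_nnsfun_approx.
have mfh n : measurable_fun setT (fun x => (f_ n x)%:E * (h x)%:E).
  by apply: emeasurable_funM => //; exact/measurable_EFinP/measurable_funP.
transitivity (limn (fun n => \int[mu]_x ((f_ n x)%:E * (h x)%:E))); last first.
  rewrite -monotone_convergence//.
  - apply: eq_integral => y _; apply/cvg_lim => //.
    by apply: cvgeZr => //; exact: cf.
  - by move=> n y _; rewrite mule_ge0// lee_fin.
  - move=> y _ m n mn; rewrite lee_wpmul2r ?lee_fin//.
    exact/lefP/nd_nnsfun_approx.
congr (limn _); apply/funext => n.
under eq_integral do rewrite fimfunE -fsumEFin//.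
rewrite ge0_integral_fsum//; last 2 first.
- by move=> r; exact/measurable_EFinP/measurableT_comp.
- by move=> r x _; rewrite nnfun_muleindic_ge0.
under [RHS]eq_integral.
  move=> x _; rewrite fimfunE -fsumEFin// ge0_mule_fsuml; last first.
    by move=> r; rewrite nnfun_muleindic_ge0.
  over.
rewrite [RHS]ge0_integral_fsum//; last 2 first.
- move=> r; apply: emeasurable_funM => //.
  exact/measurable_EFinP/measurableT_comp.
- by move=> r x _; rewrite mule_ge0 ?nnfun_muleindic_ge0// lee_fin.
apply: eq_fsbigr => r _.
rewrite integralZl_indic_nnsfun// integral_indic// setIT.
have mA : measurable (f_ n @^-1` [set r]) by exact: measurable_sfunP.
rewrite nuE//; have [r0|r0] := leP 0%R r; last first.
  rewrite preimage_nnfun0// integral_set0 mule0 integral0_eq// => x _.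
  by rewrite indicE memNset//= mulr0 mul0e.
rewrite (integral_mkcond (f_ n @^-1` [set r])) -ge0_integralZl//; last 2 first.
- by apply/(measurable_restrictT (EFin \o h) mA); exact: measurable_funTS.
- by move=> x _; rewrite /patch; case: ifPn => // _; rewrite lee_fin.
apply: eq_integral => x _; rewrite /patch indicE.
by case: (x \in _); rewrite ?mulr1 ?mulr0 ?mul0e ?mule0.
Qed.

End density.

Section affine1.
Variable R : realType.
Local Notation mu := (@lebesgue_measure R).

Definition affine (a b : R) (x : measurableTypeR R) : measurableTypeR R :=
  a * x + b.

Lemma measurable_affine a b : measurable_fun setT (affine a b).
Proof. by apply: measurable_funD => //; exact: measurable_funM. Qed.

Lemma affine_preimage_oc a b u v : a != 0 ->
  affine a b @^-1` `]u, v] =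
  if 0 < a then `](u - b) / a, (v - b) / a]%classic
  else `[(v - b) / a, (u - b) / a[%classic.
Proof.
move=> a0; apply/seteqP; split => x; rewrite /affine /=; case: ltgtP a0 => // a0 _;
  rewrite /= !in_itv/=.
- by rewrite ltr_pdivrMr// ler_pdivlMr// mulrC ltrBlDr lerBrDr.
- by rewrite ltr_ndivlMr// ler_ndivrMr// mulrC ltrBlDr lerBrDr andbC.
- by rewrite ltr_pdivrMr// ler_pdivlMr// mulrC ltrBlDr lerBrDr.
- by rewrite ltr_ndivlMr// ler_ndivrMr// mulrC ltrBlDr lerBrDr andbC.
Qed.

(** The left-hand side is a measure in A which agrees with Lebesgue measure on
    half-open intervals, and this determines it. For a < 0 the preimage of a
    half-open interval is closed at the other end. *)
Lemma lebesgue_affine_preimage a b A : a != 0 -> measurable A ->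
  (`|a|%:E * mu (affine a b @^-1` A) = mu A)%E.
Proof.
move=> a0 mA; apply/esym.
pose P : {measure set (measurableTypeR R) -> \bar R} :=
  measure_function_pushforward__canonical__measure_function_Measure
    mu (measurable_affine a b).
rewrite -[RHS]/(mscale (NngNum (normr_ge0 a)) P A).
apply: lebesgue_measure_unique mA => /= _ [[u v]] _ <-.
rewrite -[RHS]/(`|a|%:E * mu (affine a b @^-1` `]u, v]))%E.
rewrite affine_preimage_oc//=.
have [uv|vu] := ltP u v; last first.
  rewrite set_itv_ge ?bnd_simp -?leNgt// measure0.
  case: ifPn => ha.
    rewrite set_itv_ge ?measure0 ?mule0// ?bnd_simp -leNgt.
    by rewrite ler_pM2r ?invr_gt0// lerB.
  rewrite set_itv_ge ?measure0 ?mule0// ?bnd_simp -leNgt.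
  by rewrite ler_nM2r ?lerB// invr_lt0 lt_neqAle a0 leNgt.
case: ifPn => ha; rewrite !lebesgue_measure_itv/= !lte_fin uv.
  rewrite ltr_pM2r ?invr_gt0// ltrD2r uv gtr0_norm// -EFinD -EFinM.
  by congr EFin; field.
have {}ha : a < 0 by rewrite lt_neqAle a0 leNgt.
rewrite ltr_nM2r ?invr_lt0// ltrD2r uv ltr0_norm// -EFinD -EFinM.
by congr EFin; field.
Qed.

Lemma ge0_integral_affine a b (f : measurableTypeR R -> \bar R) : a != 0 ->
  measurable_fun setT f -> (forall x, 0 <= f x)%E ->
  (\int[mu]_x f x = `|a|%:E * \int[mu]_x f (affine a b x))%E.
Proof.
move=> a0 mf f0; pose P : {measure set (measurableTypeR R) -> \bar R} :=
  measure_function_pushforward__canonical__measure_function_Measure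
    mu (measurable_affine a b).
rewrite (eq_measure_integral (mscale (NngNum (normr_ge0 a)) P)); last first.
  by move=> A mA _; exact/esym/(lebesgue_affine_preimage b a0 mA).
rewrite ge0_integral_mscale//=.
rewrite ge0_integral_pushforward//; last exact: measurable_affine.
Qed.

End affine1.

(** * Borel sets and affine maps of R^n *)

Section rV_measurable.
Variables (R : realType) (n : nat).

Lemma rat_rV_dense (x : 'rV[R]_n) (e : R) : 0 < e ->
  exists q : 'rV[rat]_n, forall i, `|x ord0 i - ratr (q ord0 i)| < e.
Proof.
move=> e0.
have H i : exists q : rat, `|x ord0 i - ratr q| < e.
  have /rat_in_itvoo[q] : x ord0 i - e < x ord0 i + e by rewrite ltrD2l; lra.
  by rewrite in_itv/= => /andP[h1 h2]; exists q; rewrite ltr_norml; lra.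
have [f fP] := choice H.
by exists (\row_i f i) => i; rewrite mxE.
Qed.

(** An open set is the countable union of the open cubes with rational center
    and half-side 1 / (m + 1) contained in it, and cubes are measurable for the
    sigma-algebra generated by the coordinates. *)
Lemma measurable_rV_open (U : set 'rV[R]_n) : open U -> measurable U.
Proof.
move=> oU.
pose C (p : 'rV[rat]_n * nat) : set 'rV[R]_n :=
  [set x | forall i, `|x ord0 i - ratr (p.1 ord0 i)| < p.2.+1%:R^-1].
pose V (p : 'rV[rat]_n * nat) := if `[< C p `<=` U >] then C p else set0.
have -> : U = \bigcup_p V p.
  apply/seteqP; split => x; last first.
    by move=> [p _]; rewrite /V; case: asboolP => // CU /CU.
  move=> Ux; have : nbhs x U by exact: open_nbhs_nbhs.
  move=> /nbhs_ballP[e /= e0 eU].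
  have [m me] : exists m : nat, m.+1%:R^-1 < e / 2.
    by have [m _ /(_ m (leqnn _))] :=
      near_infty_natSinv_lt (PosNum (divr_gt0 e0 (ltr0n _ 2))); exists m.
  have [q qP] := rat_rV_dense x (e := m.+1%:R^-1) ltac:(by rewrite invr_gt0).
  exists (q, m) => //; rewrite /V; case: asboolP => // -[] y Cy.
  apply: eU; split => // i j; rewrite (ord1 i).
  change (`|x ord0 j - y ord0 j| < e).
  have /= := Cy j; rewrite ltr_norml => /andP[y1 y2].
  have := qP j; rewrite !ltr_norml => /andP[x1 x2].
  by set d := _.+1%:R^-1 in me y1 y2 x1 x2; lra.
apply: countable_bigcupT_measurable.
  exact: countableP.
move=> p; rewrite /V; case: asboolP => // _.
have -> : C p = \bigcap_(i in [set: 'I_n])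
    ((fun x : 'rV[R]_n => x ord0 i) @^-1`
     [set t | `|t - ratr (p.1 ord0 i)| < p.2.+1%:R^-1]).
  by apply/seteqP; split => x /= Cx i; [move=> _|]; exact: Cx.
apply: fin_bigcap_measurable => // i _.
rewrite -[X in measurable X]setTI; apply: measurable_rV_coord => //.
have -> : [set t : measurableTypeR R | `|t - ratr (p.1 ord0 i)| < p.2.+1%:R^-1] =
  `]ratr (p.1 ord0 i) - p.2.+1%:R^-1, ratr (p.1 ord0 i) + p.2.+1%:R^-1[%classic.
  apply/seteqP; split => t /=; rewrite in_itv/= ltr_norml => /andP[t1 t2];
    by set d := _.+1%:R^-1 in t1 t2 *; apply/andP; split; lra.
exact: measurable_itv.
Qed.

Lemma continuous_measurable_rV (f : 'rV[R]_n -> R) :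
  continuous f -> measurable_fun [set: 'rV[R]_n] f.
Proof.
move=> cf; apply: (measurability _ (RGenOpens.measurableE R)) => //.
move=> _ [_ [a [b ->]] <-]; rewrite setTI; apply: measurable_rV_open.
by apply: open_comp; [move=> x _; exact: cf|exact: interval_open].
Qed.

End rV_measurable.

Section lebesgue_rV_affine.
Variable R : realType.
Local Notation mu := (@lebesgue_measure R).
Local Open Scope ereal_scope.

Lemma measurable_rV_affine n (a : R) (b : 'rV[R]_n) :
  measurable_fun [set: 'rV[R]_n] (fun x : 'rV[R]_n => a *: x + b)%R.
Proof.
apply/measurable_fun_rVP => i.
under eq_fun do rewrite !mxE.
by apply: measurable_funD => //; apply: measurable_funM => //;
  exact: measurable_rV_coord.
Qed.

Lemma measurable_integral_rV_cons n (f : 'rV[R]_n.+1 -> \bar R) :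
  measurable_fun setT f -> (forall x, 0 <= f x) ->
  measurable_fun setT
    (fun a : measurableTypeR R => \int[lebesgue_rV R n]_v f (rV_cons (a, v))).
Proof.
move=> mf f0.
apply: (@measurable_fun_fubini_tonelli_F _ _ (measurableTypeR R) 'rV[R]_n R
  (lebesgue_rV R n) (f \o @rV_cons R n)) => //.
- by apply: measurableT_comp => //; exact: measurable_rV_cons.
- by move=> x; exact: f0.
Qed.

(** One coordinate at a time; each contributes a factor |a|. *)
Lemma ge0_integral_lebesgue_rV_affine n (a : R) (b : 'rV[R]_n)
    (f : 'rV[R]_n -> \bar R) : (a != 0)%R ->
  measurable_fun setT f -> (forall x, 0 <= f x) ->
  \int[lebesgue_rV R n]_x f x =
  (`|a| ^+ n)%:E * \int[lebesgue_rV R n]_x f (a *: x + b)%R.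
Proof.
move=> a0; elim: n b f => [|n IH] b f mf f0.
  rewrite expr0 mul1e; apply: eq_integral => x _; congr f.
  by apply/rowP => -[].
pose b0 := b ord0 ord0; pose b' : 'rV[R]_n := (\row_i b ord0 (lift ord0 i))%R.
have consE t v : (a *: rV_cons (t, v) + b = rV_cons (affine a b0 t, a *: v + b'))%R.
  apply/rowP => i; rewrite mxE [X in (X + _)%R = _]mxE.
  by have [j ->|->] := unliftP ord0 i; rewrite ?rV_consES ?rV_consE0 ?mxE.
have mcons t : measurable_fun setT (fun v : 'rV[R]_n => rV_cons (t, v)).
  by apply: measurableT_comp; [exact: measurable_rV_cons|exact: measurable_pair1].
rewrite !ge0_integral_lebesgue_rVS//; last first.
  by apply: measurableT_comp => //; exact: measurable_rV_affine.
under [X in _ = _ * X]eq_integral do under eq_integral do rewrite consE.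
rewrite (ge0_integral_affine b0 a0); last 2 first.
- exact: measurable_integral_rV_cons.
- by move=> t; apply: integral_ge0 => v _; exact: f0.
rewrite exprS EFinM -muleA; congr (_ * _).
rewrite -ge0_integralZl//; last 2 first.
- apply: (measurableT_comp (f := fun t => \int[lebesgue_rV R n]_v f (rV_cons (t, a *: v + b')%R))).
    apply: (@measurable_fun_fubini_tonelli_F _ _ (measurableTypeR R) 'rV[R]_n R
      (lebesgue_rV R n) (fun p => f (rV_cons (p.1, a *: p.2 + b')%R))) => //.
    apply: measurableT_comp => //.
    apply: (measurableT_comp (@measurable_rV_cons _ _)).
    apply/measurable_fun_pairP; split; first exact: measurable_fst.
    by apply: (measurableT_comp (measurable_rV_affine a b')).
  exact: measurable_affine.
- by move=> t _; apply: integral_ge0 => v _; exact: f0.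
apply: eq_integral => t _.
rewrite (IH b' (fun v => f (rV_cons (affine a b0 t, v))))//.
by apply: measurableT_comp.
Qed.

End lebesgue_rV_affine.

(** * The Gaussian measure: product structure and rotations *)

Section gauss_integral.
Variable R : realType.
Local Open Scope ereal_scope.
Local Notation mu := (@lebesgue_measure R).
Local Notation N := (@normal_prob R 0 1).

Lemma ge0_integral_gauss n (f : 'rV[R]_n -> \bar R) :
  measurable_fun setT f -> (forall x, 0 <= f x) ->
  \int[gauss R n]_x f x = \int[lebesgue_rV R n]_x (f x * (gauss_pdf x)%:E).
Proof.
move=> mf f0; apply: ge0_integral_density => //.
- exact: measurable_gauss_pdf.
- exact: gauss_pdf_ge0.
Qed.

Lemma ge0_integral_normal (f : measurableTypeR R -> \bar R) :
  measurable_fun setT f -> (forall x, 0 <= f x) ->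
  \int[N]_x f x = \int[mu]_x (f x * (normal_pdf 0 1 x)%:E).
Proof.
move=> mf f0; apply: (@ge0_integral_density _ (measurableTypeR R) _ mu) => //.
- exact: measurable_normal_pdf.
- exact: normal_pdf_ge0.
Qed.

Lemma ge0_integral_normalN (f : measurableTypeR R -> \bar R) :
  measurable_fun setT f -> (forall x, 0 <= f x) ->
  \int[N]_x f (- x)%R = \int[N]_x f x.
Proof.
move=> mf f0.
have mN : measurable_fun setT (fun x : measurableTypeR R => f (- x)%R).
  by apply: measurableT_comp.
rewrite !ge0_integral_normal//.
rewrite [RHS](ge0_integral_affine 0%R (a := (-1)%R))//; last 2 first.
- apply: emeasurable_funM => //; apply/measurable_EFinP.
  exact: measurable_normal_pdf.
- by move=> x; rewrite mule_ge0// lee_fin normal_pdf_ge0.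
rewrite normrN1 mul1e; apply: eq_integral => x _.
rewrite /affine addr0 mulN1r; congr (_ * _%:E).
by rewrite !normal_pdfE ?oner_eq0// /normal_fun !subr0 sqrrN.
Qed.

Lemma measurable_integral_gauss_cons n (f : 'rV[R]_n.+1 -> \bar R) :
  measurable_fun setT f -> (forall x, 0 <= f x) ->
  measurable_fun setT
    (fun a : measurableTypeR R => \int[gauss R n]_v f (rV_cons (a, v))).
Proof.
move=> mf f0.
apply: (@measurable_fun_fubini_tonelli_F _ _ (measurableTypeR R) 'rV[R]_n R
  (gauss R n) (f \o @rV_cons R n)) => //.
- by apply: measurableT_comp => //; exact: measurable_rV_cons.
- by move=> x; exact: f0.
Qed.

Lemma measurable_rV_cons1 n (a : R) :
  measurable_fun setT (fun v : 'rV[R]_n => rV_cons (a, v)).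
Proof.
by apply: measurableT_comp; [exact: measurable_rV_cons|exact: measurable_pair1].
Qed.

(** The Gaussian measure on R^(n+1) is the product of those on R and R^n, which
    is what allows inductions on the dimension. *)
Lemma ge0_integral_gaussS n (f : 'rV[R]_n.+1 -> \bar R) :
  measurable_fun setT f -> (forall x, 0 <= f x) ->
  \int[gauss R n.+1]_x f x =
  \int[N]_a \int[gauss R n]_v f (rV_cons (a, v)).
Proof.
move=> mf f0.
rewrite ge0_integral_normal//; last 2 first.
- exact: measurable_integral_gauss_cons.
- by move=> a; exact: integral_ge0.
rewrite ge0_integral_gauss// ge0_integral_lebesgue_rVS; last 2 first.
- apply: emeasurable_funM => //; apply/measurable_EFinP.
  exact: measurable_gauss_pdf.
- by move=> x; rewrite mule_ge0// lee_fin gauss_pdf_ge0.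
apply: eq_integral => a _.
have mfa : measurable_fun setT (fun v : 'rV[R]_n => f (rV_cons (a, v))).
  by apply: measurableT_comp => //; exact: measurable_rV_cons1.
rewrite ge0_integral_gauss// -ge0_integralZr//; last 3 first.
- apply: emeasurable_funM => //; apply/measurable_EFinP.
  exact: measurable_gauss_pdf.
- by move=> v _; rewrite mule_ge0// lee_fin gauss_pdf_ge0.
- by rewrite lee_fin normal_pdf_ge0.
apply: eq_integral => v _.
by rewrite gauss_pdf_cons EFinM -muleA [X in _ * X = _]muleC.
Qed.

Lemma ge0_integral_gauss_swap n (f : 'rV[R]_n.+1 -> \bar R) :
  measurable_fun setT f -> (forall x, 0 <= f x) ->
  \int[gauss R n.+1]_x f x =
  \int[gauss R n]_v \int[N]_a f (rV_cons (a, v)).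
Proof.
move=> mf f0; rewrite ge0_integral_gaussS//.
apply: (@fubini_tonelli _ _ (measurableTypeR R) 'rV[R]_n R N (gauss R n)
  (f \o @rV_cons R n)) => //.
- by apply: measurableT_comp => //; exact: measurable_rV_cons.
- by move=> x; exact: f0.
Qed.

Section rotation.
Variable n : nat.
Local Notation V := 'rV[R]_n.

Lemma measurable_rV_comb (a b : R) :
  measurable_fun setT (fun p : V * V => a *: p.1 + b *: p.2)%R.
Proof.
apply/measurable_fun_rVP => i.
under eq_fun do rewrite !mxE.
apply: measurable_funD; apply: measurable_funM => //.
  by apply: (measurableT_comp (measurable_rV_coord i)).
by apply: (measurableT_comp (measurable_rV_coord i)).
Qed.

Lemma measurable_rV_comb2 (a b c d : R) :
  measurable_fun setT
    (fun p : V * V => (a *: p.1 + b *: p.2, c *: p.1 + d *: p.2)%R).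
Proof.
by apply/measurable_fun_pairP; split; exact: measurable_rV_comb.
Qed.

Lemma ge0_integral_gauss2 (K : V * V -> \bar R) :
  measurable_fun setT K -> (forall p, 0 <= K p) ->
  \int[gauss R n]_x \int[gauss R n]_y K (x, y) =
  \int[lebesgue_rV R n]_x \int[lebesgue_rV R n]_y
    (K (x, y) * (gauss_pdf x * gauss_pdf y)%:E).
Proof.
move=> mK K0; rewrite ge0_integral_gauss; last 2 first.
- exact: (measurable_fun_fubini_tonelli_F K).
- by move=> x; exact: integral_ge0.
apply: eq_integral => x _.
have mKx : measurable_fun setT (fun y => K (x, y)).
  by apply: measurableT_comp => //; exact: measurable_pair1.
rewrite ge0_integral_gauss// -ge0_integralZr//; last 3 first.
- apply: emeasurable_funM => //; apply/measurable_EFinP.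
  exact: measurable_gauss_pdf.
- by move=> v _; rewrite mule_ge0// lee_fin gauss_pdf_ge0.
- by rewrite lee_fin gauss_pdf_ge0.
by apply: eq_integral => y _; rewrite -muleA -EFinM mulrC.
Qed.

Let s : R := (Num.sqrt 2)^-1.
Let s0 : (0 < s)%R. Proof. by rewrite invr_gt0 sqrtr_gt0. Qed.
Let ss : (s * s = 2^-1)%R.
Proof. by rewrite -expr2 exprVn sqr_sqrtr. Qed.

Definition eighth_turn (p : V * V) : V * V :=
  ((Num.sqrt 2)^-1 *: (p.2 + p.1), (Num.sqrt 2)^-1 *: (p.2 - p.1))%R.

Lemma measurable_eighth_turn : measurable_fun setT eighth_turn.
Proof.
rewrite (_ : eighth_turn = fun p : V * V => (s *: p.1 + s *: p.2, (- s) *: p.1 + s *: p.2)%R).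
  exact: measurable_rV_comb2.
apply/funext => p; rewrite /eighth_turn -/s !scalerDr scalerN scaleNr.
by congr pair; rewrite addrC.
Qed.

Lemma gauss_pdf_eighth_turn p :
  (gauss_pdf (eighth_turn p).1 * gauss_pdf (eighth_turn p).2 = gauss_pdf p.1 * gauss_pdf p.2)%R.
Proof.
rewrite /gauss_pdf [LHS]mulrACA [RHS]mulrACA -!expRD; congr (_ * expR _)%R.
rewrite /enorm !sqr_sqrtr ?dot_ge0// -!opprD -!mulrDl; congr (- (_ / _))%R.
rewrite /dot -!big_split/=; apply: eq_bigr => i _.
rewrite !mxE -/s; move: (p.1 _ _) (p.2 _ _) => u v.
by transitivity (s * s * 2 * (u * u + v * v))%R; [ring|rewrite ss; field].
Qed.

(** Factorization of the rotation, with s = 1 / sqrt 2 and s^-1 = 2 s: first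
    x = s^-1 z + y with y fixed, then y = s w - s z with z fixed. Each step is
    an affine change of one variable, and their factors s^-n and s^n cancel. *)
Lemma ge0_integral_lebesgue_eighth_turn (L : V * V -> \bar R) :
  measurable_fun setT L -> (forall p, 0 <= L p) ->
  \int[lebesgue_rV R n]_x \int[lebesgue_rV R n]_y L (x, y) =
  \int[lebesgue_rV R n]_z \int[lebesgue_rV R n]_w L (eighth_turn (z, w)).
Proof.
move=> mL L0.
pose c : R := (s ^+ n)%R.
have c0 : (0 < c)%R by rewrite exprn_gt0.
pose L1 (p : V * V) := L (s^-1 *: p.1 + p.2, p.2)%R.
have mL1 : measurable_fun setT L1.
  rewrite (_ : L1 = L \o (fun p => (s^-1 *: p.1 + 1 *: p.2, 0 *: p.1 + 1 *: p.2)%R)).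
    by apply: measurableT_comp => //; exact: measurable_rV_comb2.
  by apply/funext => p; rewrite /L1/= scale0r add0r scale1r.
have L10 p : 0 <= L1 p by exact: L0.
rewrite (fubini_tonelli L)//.
transitivity (\int[lebesgue_rV R n]_y (c^-1%:E * \int[lebesgue_rV R n]_z L1 (z, y))).
  apply: eq_integral => y _.
  rewrite [LHS](ge0_integral_lebesgue_rV_affine y (a := s^-1))//; last 2 first.
  - by rewrite invr_eq0 gt_eqF.
  - by apply: measurableT_comp => //; exact: measurable_pair2.
  by rewrite ger0_norm ?invr_ge0 ?ltW// exprVn.
rewrite ge0_integralZl//; last 3 first.
- exact: (measurable_fun_fubini_tonelli_G L1).
- by move=> x _; exact: integral_ge0.
- by rewrite lee_fin invr_ge0 ltW.
rewrite -(fubini_tonelli L1)//.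
rewrite -ge0_integralZl//; last 3 first.
- exact: (measurable_fun_fubini_tonelli_F L1).
- by move=> x _; exact: integral_ge0.
- by rewrite lee_fin invr_ge0 ltW.
apply: eq_integral => z _.
rewrite [in LHS](ge0_integral_lebesgue_rV_affine (- (s *: z))%R (a := s))//;
  last 2 first.
- by rewrite gt_eqF.
- by apply: measurableT_comp => //; exact: measurable_pair1.
rewrite ger0_norm ?ltW// muleA -EFinM mulVf ?gt_eqF// mul1e.
apply: eq_integral => w _; rewrite /L1 /eighth_turn/= -/s.
have -> : s^-1%R = (s + s)%R.
  apply: (@mulfI _ s); first by rewrite gt_eqF.
  by rewrite divff ?gt_eqF// mulrDr ss; field.
congr (L (_, _)); last by rewrite scalerBr.
by rewrite scalerDl scalerDr addrACA subrr addr0 addrC.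
Qed.

(** Rotation invariance of the Gaussian measure on R^n x R^n, for the one angle
    needed: both the product Lebesgue measure and the product of the densities,
    a function of |x|^2 + |y|^2, are invariant. *)
Lemma ge0_integral_gauss_eighth_turn (K : V * V -> \bar R) :
  measurable_fun setT K -> (forall p, 0 <= K p) ->
  \int[gauss R n]_x \int[gauss R n]_y K (x, y) =
  \int[gauss R n]_z \int[gauss R n]_w K (eighth_turn (z, w)).
Proof.
move=> mK K0.
pose K' p := K (eighth_turn p).
have mK' : measurable_fun setT K'.
  by apply: (measurableT_comp mK); exact: measurable_eighth_turn.
rewrite ge0_integral_gauss2// -[RHS]/(\int[gauss R n]_z \int[gauss R n]_w K' (z, w)).
rewrite (ge0_integral_gauss2 mK'); last by move=> p; exact: K0.
pose L p := K p * (gauss_pdf p.1 * gauss_pdf p.2)%:E.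
rewrite (ge0_integral_lebesgue_eighth_turn (L := L)).
- apply: eq_integral => z _; apply: eq_integral => w _.
  by rewrite /L /K' gauss_pdf_eighth_turn.
- apply: emeasurable_funM => //; apply/measurable_EFinP; apply: measurable_funM.
    by apply: (measurableT_comp (@measurable_gauss_pdf _ _)).
  by apply: (measurableT_comp (@measurable_gauss_pdf _ _)).
- by move=> p; rewrite mule_ge0// lee_fin mulr_ge0// gauss_pdf_ge0.
Qed.

End rotation.
End gauss_integral.

(** * The Gaussian Poincare inequality on the line *)

Section poincare1.
Variable R : realType.
Local Notation mu := (@lebesgue_measure R).
Local Notation N := (@normal_prob R 0 1).
Local Notation rho := (@normal_pdf R 0 1).

Lemma is_derive_normal_pdf (x : R) : is_derive x 1 rho (- x * rho x).
Proof.
rewrite normal_pdfE ?oner_eq0// /normal_fun.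
have -> : (fun y : R => normal_peak 1 * expR (- (y - 0) ^+ 2 / (1 ^+ 2 *+ 2)))
  = cst (normal_peak 1) * (expR \o ((- 2^-1) \*: (@idfun R ^+ 2))).
  apply/funext => y; rewrite !fctE/= subr0 expr1n; congr (_ * expR _).
  by rewrite -[_ *: _]/(_ * _); field.
have h : is_derive x 1 ((- 2^-1) \*: (@idfun R ^+ 2)) (- x).
  have h := is_deriveZ (- 2^-1) (is_deriveX 2 (is_derive_id x (1 : R))).
  apply: (is_derive_eq h); rewrite expr1 -[LHS]/(_ * (_ * _)) mulr1 -[id x]/x.
  by field.
have h2 := is_derive1_comp (is_derive_expR _) h.
apply: is_derive_eq; rewrite /= !scaler0 addr0 subr0 expr1n.
rewrite -![_ *: _]/(_ * _) (_ : - x ^+ 2 / (1 *+ 2) = - 2^-1 * x ^+ 2); last by field.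
by rewrite -[(@idfun R ^+ 2) x]/(x ^+ 2); ring.
Qed.

Section half_line.
Variables f f' : R -> R.
Hypothesis df : forall x : R, is_derive x 1 f (f' x).
Hypothesis cf' : continuous f'.
Hypothesis f0 : f 0 = 0.

Let cf : continuous f.
Proof. by move=> x; apply/differentiable_continuous/derivable1_diffP;
  case: (df x). Qed.

Let crho : continuous rho.
Proof. by apply: continuous_normal_pdf; rewrite oner_eq0. Qed.

(** With B = f^2 rho / (x + d), the integrand on the right minus the one on the
    left is B' + (f' - f / (x + d))^2 rho, and the integral of B' is
    B(M) - B(0) = B(M) >= 0. The shift d > 0 keeps B smooth at 0; for d = 0 the
    weight x / (x + d) becomes 1. *)
Lemma hardy_segment (d M : R) : 0 < d -> 0 < M ->
  (\int[mu]_(x in `[0%R, M]) (f x ^+ 2 * rho x * (`|x| / (`|x| + d)))%:E <=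
   \int[mu]_(x in `[0%R, M]) (f' x ^+ 2 * rho x)%:E)%E.
Proof.
move=> d0 M0.
have dn0 (x : R) : 0 <= x -> x + d != 0 by move=> x0; rewrite gt_eqF// ltr_wpDl.
pose B (x : R) := f x ^+ 2 * rho x * (x + d)^-1.
pose B' (x : R) := (2 * f x * f' x - x * f x ^+ 2) * rho x * (x + d)^-1
  - f x ^+ 2 * rho x * (x + d)^-1 ^+ 2.
have dB (x : R) : 0 <= x -> is_derive x 1 B (B' x).
  move=> x0; have h1 := is_derive_normal_pdf x; have h2 := df x.
  have h3 : is_derive x 1 (fun y : R => y + d) 1.
    by apply: is_derive_eq; rewrite addr0.
  have h4 := is_deriveV (f := fun y => y + d) (dn0 _ x0) h3.
  have -> : B = (f ^+ 2 * rho) * (fun y => (y + d)^-1) by [].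
  apply: is_derive_eq; rewrite /B' !fctE -![_ *: _]/(_ * _) expr1 -exprVn -mulr_natl.
  ring.
have cV : {in `[0, M], forall x, {for x, continuous (fun x : R => (x + d)^-1)}}.
  move=> x; rewrite in_itv/= => /andP[x0 _]; apply: cvgV; first exact: dn0.
  by apply: cvgD; [exact: cvg_id|exact: cvg_cst].
have cB' : {within `[0, M], continuous B'}.
  apply: continuous_in_subspaceT => x /[!inE] xM.
  have := cV x xM => cVx.
  apply: cvgB; last first.
    apply: cvgM; last by rewrite expr2; apply: cvgM.
    by apply: cvgM; [apply: cvgM; exact: cf|exact: crho].
  apply: cvgM => //; apply: cvgM; last exact: crho.
  apply: cvgB.
    by apply: cvgM; [apply: cvgM; [exact: cvg_cst|exact: cf]|exact: cf'].
  by apply: cvgM; [exact: cvg_id|apply: cvgM; exact: cf].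
have intB' : (\int[mu]_(x in `[0%R, M]) (B' x)%:E = (B M)%:E - (B 0)%:E)%E.
  apply: continuous_FTC2 => //.
    have cB x : 0 <= x -> {for x, continuous B}.
      by move=> /dB[? _]; exact/differentiable_continuous/derivable1_diffP.
    split.
    - by move=> x; rewrite in_itv/= => /andP[/ltW/dB[]].
    - by apply: cvg_at_right_filter; exact: cB.
    - by apply: cvg_at_left_filter; apply: cB; exact: ltW.
  move=> x; rewrite in_itv/= => /andP[/ltW/dB h _].
  by rewrite derive1E; case: h.
have ic h : {within `[0, M], continuous h} -> mu.-integrable `[0, M] (EFin \o h).
  by move=> ch; apply: continuous_compact_integrable => //; exact: segment_compact.
pose G (x : R) := f x ^+ 2 * rho x * (`|x| / (`|x| + d)).
have iG : mu.-integrable `[0, M] (EFin \o G).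
  apply: ic; apply: continuous_subspaceT => x.
  have cn : {for x, continuous (fun y : R => `|y|)} by exact: norm_continuous.
  apply: cvgM; first by apply: cvgM; [apply: cvgM; exact: cf|exact: crho].
  apply: cvgM => //; apply: cvgV; first by rewrite gt_eqF// ltr_wpDl.
  by apply: cvgD => //; exact: cvg_cst.
have iF : mu.-integrable `[0, M] (EFin \o (fun x => f' x ^+ 2 * rho x)).
  apply: ic; apply: continuous_subspaceT => x.
  by apply: cvgM; [apply: cvgM; exact: cf'|exact: crho].
have iB := ic _ cB'.
apply: (@le_trans _ _ (\int[mu]_(x in `[0%R, M]) (G x)%:E
    + \int[mu]_(x in `[0%R, M]) (B' x)%:E))%E.
  rewrite leeDl// intB' -EFinB lee_fin /B f0 expr0n !mul0r subr0.
  apply: mulr_ge0; first by rewrite mulr_ge0 ?sqr_ge0 ?normal_pdf_ge0.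
  by rewrite invr_ge0 addr_ge0 ?ltW.
rewrite -integralD//=; apply: le_integral => //=.
  exact: (integrableD _ iG iB).
move=> x /[!inE]/=; rewrite in_itv/= => /andP[x0 xM]; rewrite -EFinD lee_fin.
rewrite /G /B' ger0_norm// -subr_ge0.
have -> : f' x ^+ 2 * rho x - (f x ^+ 2 * rho x * (x / (x + d)) +
    ((2 * f x * f' x - x * f x ^+ 2) * rho x * (x + d)^-1 -
     f x ^+ 2 * rho x * (x + d)^-1 ^+ 2))
  = (f' x - f x / (x + d)) ^+ 2 * rho x by ring.
by rewrite mulr_ge0 ?sqr_ge0 ?normal_pdf_ge0.
Qed.

(** Monotone convergence, along M = m tending to infinity and then along
    d = 1 / (k + 1) tending to 0. *)
Lemma hardy_half_line :
  (\int[mu]_(x in `[0%R, +oo[) (f x ^+ 2 * rho x)%:E <=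
   \int[mu]_(x in `[0%R, +oo[) (f' x ^+ 2 * rho x)%:E)%E.
Proof.
pose d (k : nat) : R := k.+1%:R^-1.
have d0 k : 0 < d k by rewrite invr_gt0.
pose G k (x : R) := f x ^+ 2 * rho x * (`|x| / (`|x| + d k)).
have mf2 (h : R -> R) : continuous h ->
  measurable_fun setT (fun x : R => h x ^+ 2 * rho x).
  move=> ch; apply: measurable_funM; last exact: measurable_normal_pdf.
  by apply: measurable_funX; exact: continuous_measurable_fun.
have mG k : measurable_fun setT (G k).
  apply: measurable_funM; first exact: mf2.
  apply: continuous_measurable_fun => x.
  have cn : {for x, continuous (fun y : R => `|y|)} by exact: norm_continuous.
  apply: cvgM => //; apply: cvgV; first by rewrite gt_eqF// ltr_wpDl.
  by apply: cvgD => //; exact: cvg_cst.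
have f2ge0 h x : 0 <= h x ^+ 2 * rho x by rewrite mulr_ge0 ?sqr_ge0 ?normal_pdf_ge0.
have G0 k x : 0 <= G k x.
  by rewrite mulr_ge0// divr_ge0// addr_ge0// ltW.
have Gle k : (\int[mu]_(x in `[0%R, +oo[) (G k x)%:E <=
   \int[mu]_(x in `[0%R, +oo[) (f' x ^+ 2 * rho x)%:E)%E.
  have cG := ge0_cvgn_integral (mu := mu) (G0 k) (mG k).
  rewrite -(cvg_lim _ cG)//; apply: lime_le; first by apply/cvg_ex; eexists;
    exact: cG.
  near=> m.
  apply: le_trans (hardy_segment (d0 k) _) _.
    by rewrite ltr0n; near: m; exists 1%N.
  apply: ge0_subset_integral => //=.
  - by apply/measurable_EFinP; apply: measurable_funTS; exact: mf2.
  - by move=> x _; rewrite lee_fin.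
  - by apply: subset_itvl.
have cvgG : (\int[mu]_(x in `[0%R, +oo[) (G k x)%:E @[k --> \oo] -->
   \int[mu]_(x in `[0%R, +oo[) limn (fun k => (G k x)%:E))%E.
  apply: cvg_monotone_convergence => //.
  - by move=> k; apply/measurable_EFinP; apply: measurable_funTS; exact: mG.
  - by move=> k x _; rewrite lee_fin.
  - move=> x _ k m km; rewrite lee_fin ler_wpM2l//.
    have [->|x0] := eqVneq x 0; first by rewrite normr0 !mul0r.
    rewrite ler_pM2l ?normr_gt0//.
    rewrite lef_pV2 ?posrE ?ltr_wpDl// lerD2l /d.
    by rewrite lef_pV2 ?posrE ?ltr0n// ler_nat.
have limG x : limn (fun k => (G k x)%:E) = (f x ^+ 2 * rho x)%:E.
  apply/cvg_lim => //; apply: cvg_EFin; first exact: nearW.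
  have [->|x0] := eqVneq x 0.
    by rewrite f0 expr0n mul0r /G; under eq_fun do rewrite f0 expr0n !mul0r;
      exact: cvg_cst.
  rewrite -[X in _ --> X]mulr1; apply: cvgM; first exact: cvg_cst.
  rewrite -(divff (_ : `|x| != 0)) ?normr_eq0//.
  apply: cvgM; first exact: cvg_cst.
  apply: cvgV; first by rewrite normr_eq0.
  rewrite -[X in _ --> X]addr0; apply: cvgD; first exact: cvg_cst.
  exact: cvg_harmonic.
under eq_integral do rewrite -limG.
rewrite -(cvg_lim _ cvgG)//; apply: lime_le.
  by apply/cvg_ex; eexists; exact: cvgG.
exact: nearW.
Unshelve. all: by end_near. Qed.

End half_line.

Lemma ge0_integral_half_lines (h : R -> R) : measurable_fun setT h ->
  (forall x, 0 <= h x) ->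
  (\int[mu]_x (h x)%:E = \int[mu]_(x in `[0%R, +oo[) (h x)%:E +
                         \int[mu]_(x in `[0%R, +oo[) (h (- x))%:E)%E.
Proof.
move=> mh h0.
have mhE : measurable_fun [set: measurableTypeR R] (EFin \o h)
  by exact/measurable_EFinP.
rewrite (ge0_integration_by_substitution0 (f := fun x => (h (- x))%:E)); last 2 first.
- by apply/measurable_EFinP; apply: measurableT_comp.
- by move=> x; rewrite lee_fin.
under [X in (_ = _ + X)%E]eq_integral do rewrite opprK.
rewrite -integral_itv_bndo_bndc; last exact: measurable_funTS.
rewrite addeC -ge0_integral_setU//=.
- by congr integral; apply/seteqP; split => x //= _; rewrite !in_itv/= andbT;
    case: (ltP x 0); [left|right].
- exact: measurable_funTS.
- by move=> x _; rewrite lee_fin.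
- rewrite disj_set2E; apply/eqP; rewrite -subset0 => x []/=.
  by rewrite !in_itv/= andbT => h1 h2; move: (lt_le_trans h1 h2); rewrite ltxx.
Qed.

(** Vanishing at 0 replaces the usual condition that f has mean 0: the two
    half-lines then decouple, and odd functions satisfy it. *)
Lemma poincare_normal (f f' : R -> R) :
  (forall x : R, is_derive x 1 f (f' x)) -> continuous f' -> f 0 = 0 ->
  (\int[N]_x (f x ^+ 2)%:E <= \int[N]_x (f' x ^+ 2)%:E)%E.
Proof.
move=> df cf' f0.
have cf : continuous f.
  by move=> x; apply/differentiable_continuous/derivable1_diffP; case: (df x).
have mf2 (h : R -> R) : continuous h ->
  measurable_fun setT (fun x : R => h x ^+ 2 * rho x).
  move=> ch; apply: measurable_funM; last exact: measurable_normal_pdf.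
  by apply: measurable_funX; exact: continuous_measurable_fun.
have f2ge0 h x : 0 <= h x ^+ 2 * rho x by rewrite mulr_ge0 ?sqr_ge0 ?normal_pdf_ge0.
have E (h : R -> R) : continuous h -> (\int[N]_x (h x ^+ 2)%:E =
  \int[mu]_(x in `[0%R, +oo[) (h x ^+ 2 * rho x)%:E +
  \int[mu]_(x in `[0%R, +oo[) (h (- x) ^+ 2 * rho x)%:E)%E.
  move=> ch; rewrite ge0_integral_normal; last 2 first.
  - apply/measurable_EFinP; apply: measurable_funX; exact: continuous_measurable_fun.
  - by move=> x; rewrite lee_fin sqr_ge0.
  under eq_integral do rewrite -EFinM.
  rewrite (ge0_integral_half_lines (mf2 h ch) (f2ge0 h)).
  congr (_ + _)%E; apply: eq_integral => x _; congr (_ * _)%:E.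
  by rewrite !normal_pdfE ?oner_eq0// /normal_fun !subr0 sqrrN.
rewrite !E//; apply: leeD; first exact: hardy_half_line.
apply: le_trans (hardy_half_line (f := fun x => f (- x)) (f' := fun x => - f' (- x)) _ _ _) _.
- move=> x; have h1 := df (- x); have h2 := is_deriveNid x (1 : R).
  have h := is_derive1_comp h1 h2.
  by apply: (is_derive_eq h); rewrite mulrN1.
- move=> x; apply: cvgN; apply: (@continuous_comp _ _ _ (-%R) f');
    first exact: oppr_continuous.
  exact: cf'.
- by rewrite oppr0.
by under eq_integral do rewrite sqrrN.
Qed.

End poincare1.

(** * Functions with continuous partial derivatives *)

Section C1.
Variable R : realType.

(** A sends the line through x in direction v to the line through A x in
    direction w, so the two difference quotients are the same function. This
    is the chain rule for all the affine substitutions below. *)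
Lemma is_derive_affine (V W U : normedModType R) (A : V -> W) (f : W -> U)
    (x v : V) (w : W) (d : U) :
  (forall h : R, A (h *: v + x) = h *: w + A x) ->
  is_derive x v (f \o A) d <-> is_derive (A x) w f d.
Proof.
move=> hA.
have E : (fun h : R => h^-1 *: (((f \o A) \o shift x) (h *: v) - (f \o A) x)) =
         (fun h : R => h^-1 *: ((f \o shift (A x)) (h *: w) - f (A x))).
  by apply/funext => h; rewrite /= hA.
have E1 : derivable (f \o A) x v = derivable f (A x) w.
  exact: (f_equal (fun q : R -> U => cvg (q @ (0 : R)^')) E).
have E2 : 'D_v (f \o A) x = 'D_w f (A x).
  exact: (f_equal (fun q : R -> U => lim (q @ (0 : R)^')) E).
split => -[h1 h2]; apply: DeriveDef.
- by rewrite -E1.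
- by rewrite -E2.
- by rewrite E1.
- by rewrite E2.
Qed.

Lemma is_derive_line (V U : normedModType R) (f : V -> U) (x v : V) (d : U) :
  is_derive (0 : R) 1 (fun t : R => f (t *: v + x)) d <-> is_derive x v f d.
Proof.
have H (h : R) : (fun t : R => t *: v + x) (h *: 1 + 0) =
    h *: v + (fun t : R => t *: v + x) 0.
  by rewrite addr0 scale0r add0r -[h *: 1]/(h * 1) mulr1.
by rewrite (is_derive_affine (A := fun t : R => t *: v + x) f d H) /= scale0r add0r.
Qed.

Lemma is_derive_dirZ (V : normedModType R) (f : V -> R) (x v : V) (a d : R) :
  is_derive x v f d -> is_derive x (a *: v) f (a * d).
Proof.
move=> /is_derive_line h; apply/is_derive_line.
have h2 : is_derive (0 : R) (1 : R) (fun t : R => t * a) a.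
  have h3 := is_deriveM (is_derive_id (0 : R) (1 : R)) (is_derive_cst a (0 : R) (1 : R)).
  by apply: (is_derive_eq h3); rewrite scaler0 add0r -[_ *: _]/(_ * _) mulr1.
have h' : is_derive ((fun t : R => t * a) 0) 1 (fun t : R => f (t *: v + x)) d.
  by rewrite /= mul0r.
have h3 := is_derive1_comp (g := fun t : R => t * a) h' h2.
rewrite (_ : (fun t => _) = (fun t : R => f (t *: v + x)) \o (fun t : R => t * a)).
  by apply: (is_derive_eq h3); rewrite mulrC.
by apply/funext => t /=; rewrite scalerA.
Qed.

Section continuity.
Variable T : topologicalType.
Implicit Types f g : T -> R.

Lemma cont_cst (a : R) : continuous (fun _ : T => a).
Proof. by move=> x; exact: cvg_cst. Qed.

Lemma contM f g : continuous f -> continuous g -> continuous (fun x => f x * g x).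
Proof. by move=> cf cg x; apply: cvgM; [exact: cf|exact: cg]. Qed.

Lemma contD f g : continuous f -> continuous g -> continuous (fun x => f x + g x).
Proof. by move=> cf cg x; apply: cvgD; [exact: cf|exact: cg]. Qed.

Lemma contB f g : continuous f -> continuous g -> continuous (fun x => f x - g x).
Proof. by move=> cf cg x; apply: cvgB; [exact: cf|exact: cg]. Qed.

Lemma contX f n : continuous f -> continuous (fun x => f x ^+ n).
Proof.
move=> cf; elim: n => [|n IH]; first exact: cont_cst.
by under eq_fun do rewrite exprS; exact: contM.
Qed.

Lemma cont_sum n (f : 'I_n -> T -> R) : (forall i, continuous (f i)) ->
  continuous (fun x => \sum_(i < n) f i x).
Proof.
elim: n f => [|n IH] f cf.
  by under eq_fun do rewrite big_ord0; exact: cont_cst.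
under eq_fun do rewrite big_ord_recl.
by apply: contD; [exact: cf|apply: IH => i; exact: cf].
Qed.

Lemma cont_comp (U : topologicalType) (A : T -> U) (f : U -> R) :
  continuous A -> continuous f -> continuous (fun x => f (A x)).
Proof. by move=> cA cf x; apply: (continuous_comp (cA x)); exact: cf. Qed.

End continuity.

Lemma nonexpansive_continuous (U V : pseudoMetricType R) (A : U -> V) :
  (forall x e y, 0 < e -> ball x e y -> ball (A x) e (A y)) -> continuous A.
Proof.
move=> hA x; apply/cvg_ballP => e e0; near=> y; apply: hA => //.
by near: y; exact: nbhsx_ballx.
Unshelve. all: by end_near. Qed.

Lemma continuous_affine_map (V : normedModType R) (a : R) (b : V) :
  continuous (fun z : V => a *: z + b).
Proof.
move=> z; apply: cvgD; last exact: cvg_cst.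
by apply: cvgZ; [exact: cvg_cst|exact: cvg_id].
Qed.

(** The gradient is part of the data, so that a field and its Jacobian matrix can
    be passed to a statement together. Stated coordinatewise, the class is
    visibly stable under slicing, which inductions on the dimension use. *)
Definition C1 n (f : 'rV[R]_n -> R) (df : 'I_n -> 'rV[R]_n -> R) : Prop :=
  continuous f /\ forall i, continuous (df i) /\
    forall x, is_derive x (delta_mx ord0 i) f (df i x).

Lemma C1_affine n (f : 'rV[R]_n -> R) df (a : R) (b : 'rV[R]_n) : C1 f df ->
  C1 (fun z => f (a *: z + b)) (fun i z => a * df i (a *: z + b)).
Proof.
have ca := @continuous_affine_map 'rV[R]_n a b.
move=> [cf H]; split=> [|i]; first exact: cont_comp ca cf.
have [cd dd] := H i; split => [|z].
  by apply: contM; [exact: cont_cst|exact: cont_comp ca cd].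
apply/(is_derive_affine (A := fun z => a *: z + b) f (w := a *: delta_mx ord0 i)).
  by move=> h; rewrite scalerDr !scalerA addrA mulrC.
exact: is_derive_dirZ.
Qed.

Lemma C1_comb n (f g : 'rV[R]_n -> R) df dg (a b : R) : C1 f df -> C1 g dg ->
  C1 (fun z => a * f z + b * g z) (fun i z => a * df i z + b * dg i z).
Proof.
move=> [cf Hf] [cg Hg]; split=> [|i].
  by apply: contD; apply: contM => //; exact: cont_cst.
have [cdf ddf] := Hf i; have [cdg ddg] := Hg i; split=> [|z].
  by apply: contD; apply: contM => //; exact: cont_cst.
have h1 := is_deriveZ a (ddf z); have h2 := is_deriveZ b (ddg z).
exact: (is_deriveD h1 h2).
Qed.

Lemma C1_mul n (f g : 'rV[R]_n -> R) df dg : C1 f df -> C1 g dg ->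
  C1 (fun z => f z * g z) (fun i z => df i z * g z + f z * dg i z).
Proof.
move=> [cf Hf] [cg Hg]; split=> [|i]; first exact: contM.
have [cdf ddf] := Hf i; have [cdg ddg] := Hg i; split=> [|z].
  by apply: contD; apply: contM.
apply: (is_derive_eq (is_deriveM (ddf z) (ddg z))).
by rewrite -![_ *: _]/(_ * _) addrC mulrC.
Qed.

Lemma continuous_rV_cons n (a : R) :
  continuous (fun v : 'rV[R]_n => rV_cons (a, v)).
Proof.
apply: nonexpansive_continuous => v e w e0 [_ vw].
split => // i j; rewrite (ord1 i).
have [k ->|->] := unliftP ord0 j; rewrite ?rV_consES ?rV_consE0 /=.
  exact: vw.
exact: ballxx.
Qed.

Lemma continuous_rV_cons_head n (v : 'rV[R]_n) :
  continuous (fun a : R => rV_cons (a, v)).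
Proof.
apply: nonexpansive_continuous => a e b e0 ab.
split => // i j; rewrite (ord1 i).
have [k ->|->] := unliftP ord0 j; rewrite ?rV_consES ?rV_consE0 //=.
exact: ballxx.
Qed.

Lemma C1_cons n (f : 'rV[R]_n.+1 -> R) df (a : R) : C1 f df ->
  C1 (fun v => f (rV_cons (a, v))) (fun i v => df (lift ord0 i) (rV_cons (a, v))).
Proof.
have ca := @continuous_rV_cons n a.
move=> [cf H]; split=> [|i]; first exact: cont_comp ca cf.
have [cd dd] := H (lift ord0 i); split => [|v]; first exact: cont_comp ca cd.
apply/(is_derive_affine (A := fun v => rV_cons (a, v)) f
  (w := delta_mx ord0 (lift ord0 i))).
move=> h; apply/rowP => j; rewrite [RHS]mxE [X in _ = X + _]mxE.
have [k ->|->] := unliftP ord0 j; rewrite ?rV_consES ?rV_consE0 !mxE.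
  by rewrite (inj_eq (@lift_inj _ ord0)).
by rewrite !eqxx /= mulr0 add0r.
Qed.

Lemma C1_head n (f : 'rV[R]_n.+1 -> R) df (v : 'rV[R]_n) (a : R) : C1 f df ->
  is_derive a 1 (fun a => f (rV_cons (a, v))) (df ord0 (rV_cons (a, v))).
Proof.
move=> [_ H]; have [_ dd] := H ord0.
apply/(is_derive_affine (A := fun a => rV_cons (a, v)) f (w := delta_mx ord0 ord0)).
  move=> h; apply/rowP => j; rewrite [RHS]mxE [X in _ = X + _]mxE.
  have [k ->|->] := unliftP ord0 j; rewrite ?rV_consES ?rV_consE0 !mxE.
    by rewrite !eqxx /= mulr0 add0r.
  by rewrite !eqxx.
Qed.

End C1.

(** * Gaussian Poincare inequalities for odd and for even functions *)

Section flip.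
Variables (R : realType) (n : nat).
Local Notation N := (@normal_prob R 0 1).

Definition flip (x : 'rV[R]_n.+1) : 'rV[R]_n.+1 :=
  \row_i (if i == ord0 then - x ord0 i else x ord0 i).

Lemma flip_cons (a : R) (v : 'rV[R]_n) : flip (rV_cons (a, v)) = rV_cons (- a, v).
Proof.
apply/rowP => j; rewrite mxE.
by have [k ->|->] := unliftP ord0 j; rewrite ?rV_consES ?rV_consE0 ?eqxx.
Qed.

Lemma measurable_flip : measurable_fun setT flip.
Proof.
apply/measurable_fun_rVP => i; under eq_fun do rewrite mxE.
case: (i == ord0); last exact: measurable_rV_coord.
by apply: measurableT_comp => //; exact: measurable_rV_coord.
Qed.

Local Open Scope ereal_scope.

Lemma ge0_integral_gauss_flip (h : 'rV[R]_n.+1 -> \bar R) :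
  measurable_fun setT h -> (forall x, 0 <= h x) ->
  \int[gauss R n.+1]_x h (flip x) = \int[gauss R n.+1]_x h x.
Proof.
move=> mh h0; rewrite !ge0_integral_gauss_swap//; last first.
  by apply: measurableT_comp => //; exact: measurable_flip.
apply: eq_integral => v _.
under eq_integral do rewrite flip_cons.
rewrite (ge0_integral_normalN (f := fun a => h (rV_cons (a, v))))//.
apply: measurableT_comp => //; apply: measurableT_comp => //.
exact: measurable_rV_cons.
Qed.

(** Used with a square for h: the mean of f^2 at x and at flip x is the sum of
    the squares of the parts of f that are even and odd in the first
    coordinate. *)
Lemma ge0_integral_gauss_sym (h : 'rV[R]_n.+1 -> R) :
  measurable_fun setT h -> (forall x, (0 <= h x)%R) ->
  \int[gauss R n.+1]_x (2^-1 * (h x + h (flip x)))%:E =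
  \int[gauss R n.+1]_x (h x)%:E.
Proof.
move=> mh h0.
have mhE : measurable_fun setT (EFin \o h) by exact/measurable_EFinP.
have mhf : measurable_fun setT (fun x => (h (flip x))%:E).
  by apply/measurable_EFinP; apply: measurableT_comp => //; exact: measurable_flip.
under eq_integral do rewrite EFinM EFinD.
rewrite ge0_integralZl//; last 2 first.
- exact: emeasurable_funD.
- by move=> x _; rewrite -EFinD lee_fin addr_ge0.
rewrite ge0_integralD//; last 2 first.
- by move=> x _; rewrite lee_fin.
- by move=> x _; rewrite lee_fin.
have := ge0_integral_gauss_flip mhE; rewrite /comp => ->; last first.
  by move=> x; rewrite lee_fin.
have : 0 <= \int[gauss R n.+1]_x (h x)%:E.
  by apply: integral_ge0 => x _; rewrite lee_fin.
case: (integral _ _ _) => // [r|] _.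
  by rewrite -EFinD -EFinM; congr EFin; lra.
by rewrite /= gt0_muley// lte_fin invr_gt0.
Qed.

End flip.

Section poincare.
Variable R : realType.
Local Notation N := (@normal_prob R 0 1).
Local Open Scope ereal_scope.

Lemma lee_double (a b : \bar R) : 0 <= a -> 0 <= b -> a + a <= b + b -> a <= b.
Proof.
case: b => [b| |] a0 b0 h; last 2 first.
- by rewrite leey.
- by move: b0; rewrite leeNy_eq.
case: a a0 h => [a| |] a0 h; last 2 first.
- by move: h; rewrite addye.
- by move: a0; rewrite leeNy_eq.
by move: h; rewrite -!EFinD !lee_fin => h; lra.
Qed.

Lemma measurable_C1 n (f : 'rV[R]_n -> R) df : C1 f df ->
  measurable_fun setT f /\ forall i, measurable_fun setT (df i).
Proof.
move=> [cf H]; split=> [|i]; apply: continuous_measurable_rV => //.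
by have [] := H i.
Qed.

Lemma measurable_sum_sqr n m (F : 'I_m -> 'rV[R]_n -> R) :
  (forall i, measurable_fun setT (F i)) ->
  measurable_fun setT (fun x => \sum_(i < m) F i x ^+ 2)%R.
Proof. by move=> mF; apply: measurable_sum => i; exact: measurable_funX. Qed.

Lemma sum_sqr_ge0 m (a : 'I_m -> R) : (0 <= \sum_(i < m) a i ^+ 2)%R.
Proof. by apply: sumr_ge0 => i _; exact: sqr_ge0. Qed.

(** An odd f splits as f_oe + f_eo according to its parity in the first
    coordinate: f_oe vanishes when the first coordinate does, so that the
    one-dimensional inequality applies to it, while f_eo is odd in the other
    coordinates, which is the induction hypothesis. *)
Lemma poincare_odd n (f : 'rV[R]_n -> R) df : C1 f df ->
  (forall x, f (- x) = - f x)%R ->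
  \int[gauss R n]_x (f x ^+ 2)%:E <=
  \int[gauss R n]_x (\sum_(i < n) df i x ^+ 2)%:E.
Proof.
elim: n f df => [|n IH] f df Cf fodd.
  under eq_integral => x _.
    have -> : f x = 0%R.
      have := fodd x; rewrite (_ : - x = x)%R; last by apply/rowP => -[].
      by lra.
    rewrite expr0n/=; over.
  rewrite integral0; apply: integral_ge0 => x _.
  by rewrite lee_fin sum_sqr_ge0.
have [mf mdf] := measurable_C1 Cf.
have mflip (h : 'rV[R]_n.+1 -> R) : measurable_fun setT h ->
    measurable_fun setT (fun x => h (flip x)).
  by move=> mh; apply: measurableT_comp => //; exact: measurable_flip.
have mE (h : 'rV[R]_n.+1 -> R) : measurable_fun setT h ->
    measurable_fun setT (EFin \o h).
  by move=> mh; exact/measurable_EFinP.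
pose sy (h : 'rV[R]_n.+1 -> R) x : R := (2^-1 * h x + 2^-1 * h (flip x))%R.
pose as_ (h : 'rV[R]_n.+1 -> R) x : R := (2^-1 * h x + - 2^-1 * h (flip x))%R.
have msy h : measurable_fun setT h -> measurable_fun setT (sy h).
  by move=> mh; apply: measurable_funD; apply: measurable_funM => //; exact: mflip.
have mas h : measurable_fun setT h -> measurable_fun setT (as_ h).
  by move=> mh; apply: measurable_funD; apply: measurable_funM => //; exact: mflip.
have split_f : \int[gauss R n.+1]_x (f x ^+ 2)%:E =
    \int[gauss R n.+1]_x (as_ f x ^+ 2)%:E + \int[gauss R n.+1]_x (sy f x ^+ 2)%:E.
  rewrite -(ge0_integral_gauss_sym (h := fun x => f x ^+ 2)%R); last 2 first.
  - exact: measurable_funX.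
  - by move=> x; exact: sqr_ge0.
  rewrite -ge0_integralD//; last 4 first.
  - by move=> x _; rewrite lee_fin sqr_ge0.
  - by apply: mE; apply: measurable_funX; exact: mas.
  - by move=> x _; rewrite lee_fin sqr_ge0.
  - by apply: mE; apply: measurable_funX; exact: msy.
  apply: eq_integral => x _; rewrite -EFinD; congr EFin.
  by rewrite /as_ /sy; field.
have oe_le : \int[gauss R n.+1]_x (as_ f x ^+ 2)%:E <=
    \int[gauss R n.+1]_x (df ord0 x ^+ 2)%:E.
  apply: (@le_trans _ _ (\int[gauss R n.+1]_x (sy (df ord0) x ^+ 2)%:E)).
    rewrite !ge0_integral_gauss_swap; last 4 first.
    - by apply: mE; apply: measurable_funX; exact: msy.
    - by move=> x; rewrite lee_fin sqr_ge0.
    - by apply: mE; apply: measurable_funX; exact: mas.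
    - by move=> x; rewrite lee_fin sqr_ge0.
    have mcons (h : 'rV[R]_n.+1 -> R) : measurable_fun setT h ->
       measurable_fun setT (fun v => \int[N]_a (h (rV_cons (a, v)) ^+ 2)%:E).
      move=> mh.
      apply: (@measurable_fun_fubini_tonelli_G _ _ (measurableTypeR R) 'rV[R]_n R
        N (fun p => (h (rV_cons p) ^+ 2)%:E)).
        apply/measurable_EFinP; apply: measurable_funX; apply: measurableT_comp => //.
        exact: measurable_rV_cons.
      by move=> p; rewrite lee_fin sqr_ge0.
    apply: ge0_le_integral => //.
    - by move=> v _; apply: integral_ge0 => a _; rewrite lee_fin sqr_ge0.
    - by apply: mcons; exact: mas.
    - by apply: mcons; exact: msy.
    move=> v _.
    apply: (@poincare_normal R (fun a => as_ f (rV_cons (a, v)))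
      (fun a => sy (df ord0) (rV_cons (a, v)))).
    - move=> a.
      have h1 := C1_head v a Cf.
      have h2 := C1_head v (- a)%R Cf.
      have h3 := is_derive1_comp h2 (is_deriveNid a (1%R : R)).
      rewrite (_ : (fun a0 => as_ f (rV_cons (a0, v))) =
        (2^-1 \*: (fun a => f (rV_cons (a, v))) +
         (- 2^-1) \*: ((fun a => f (rV_cons (a, v))) \o -%R))%R); last first.
        by apply/funext => b; rewrite /as_ flip_cons.
      apply: (is_derive_eq (is_deriveD (is_deriveZ _ h1) (is_deriveZ _ h3))).
      by rewrite /sy flip_cons -![_ *: _]/(_ * _)%R mulrN1 mulrNN.
    - have cd : continuous (fun a : R => df ord0 (rV_cons (a, v))).
        apply: cont_comp; first exact: continuous_rV_cons_head.
        by have [_ /(_ ord0)[]] := Cf.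
      rewrite /sy; under eq_fun do rewrite flip_cons.
      apply: contD; apply: contM; [exact: cont_cst|exact: cd|exact: cont_cst|].
      by apply: (cont_comp (A := -%R) _ cd); exact: oppr_continuous.
    - by rewrite /as_ flip_cons oppr0; lra.
  rewrite -[leRHS](ge0_integral_gauss_sym (h := fun x => df ord0 x ^+ 2)%R);
    last 2 first.
  - exact: measurable_funX.
  - by move=> x; exact: sqr_ge0.
  apply: ge0_le_integral => //.
  - by move=> x _; rewrite lee_fin sqr_ge0.
  - by apply: mE; apply: measurable_funX; exact: msy.
  - apply: mE; apply: measurable_funM => //; apply: measurable_funD.
      exact: measurable_funX.
    by apply: measurable_funX; exact: mflip.
  move=> x _; rewrite lee_fin /sy -subr_ge0.
  set u := df _ _; set w := df _ _.
  by rewrite (_ : _ - _ = (2^-1 * (u - w)) ^+ 2)%R ?sqr_ge0//; field.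
pose S x : R := (\sum_(i < n) df (lift ord0 i) x ^+ 2)%R.
have S0 x : (0 <= S x)%R by exact: sum_sqr_ge0.
have mS : measurable_fun setT S by exact: measurable_sum_sqr.
have eo_le : \int[gauss R n.+1]_x (sy f x ^+ 2)%:E <= \int[gauss R n.+1]_x (S x)%:E.
  pose T x : R := (\sum_(i < n) sy (df (lift ord0 i)) x ^+ 2)%R.
  have mT : measurable_fun setT T by apply: measurable_sum_sqr => i; exact: msy.
  apply: (@le_trans _ _ (\int[gauss R n.+1]_x (T x)%:E)).
    rewrite !ge0_integral_gaussS; last 4 first.
    - exact: mE.
    - by move=> x; rewrite lee_fin sum_sqr_ge0.
    - by apply: mE; apply: measurable_funX; exact: msy.
    - by move=> x; rewrite lee_fin sqr_ge0.
    apply: ge0_le_integral => //.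
    - by move=> v _; apply: integral_ge0 => a _; rewrite lee_fin sqr_ge0.
    - apply: (measurable_integral_gauss_cons (f := fun x => (sy f x ^+ 2)%:E)).
        by apply: mE; apply: measurable_funX; exact: msy.
      by move=> x; rewrite lee_fin sqr_ge0.
    - apply: (measurable_integral_gauss_cons (f := fun x => (T x)%:E)).
        exact: mE.
      by move=> x; rewrite lee_fin sum_sqr_ge0.
    move=> a _; rewrite /T /sy.
    under eq_integral do rewrite flip_cons.
    under [leRHS]eq_integral do under eq_bigr do rewrite flip_cons.
    apply: (IH _ _ (C1_comb 2^-1 2^-1 (C1_cons a Cf) (C1_cons (- a)%R Cf))).
    move=> v.
    have neg b : rV_cons (b, - v)%R = (- rV_cons (- b, v))%R.
      apply/rowP => j; rewrite [RHS]mxE.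
      have [k ->|->] := unliftP ord0 j; rewrite ?rV_consES ?rV_consE0 ?mxE//=.
      by rewrite opprK.
    by rewrite !neg !fodd opprK; ring.
  rewrite -[leRHS](ge0_integral_gauss_sym (h := S))//.
  apply: ge0_le_integral => //.
  - by move=> x _; rewrite lee_fin sum_sqr_ge0.
  - exact: mE.
  - apply: mE; apply: measurable_funM => //; apply: measurable_funD => //.
    exact: mflip.
  move=> x _; rewrite lee_fin /T /S -big_split mulr_sumr; apply: ler_sum => i _.
  rewrite /sy -subr_ge0/=; set u := df _ _; set w := df _ _.
  by rewrite (_ : _ - _ = (2^-1 * (u - w)) ^+ 2)%R ?sqr_ge0//; field.
rewrite split_f; apply: le_trans (leeD oe_le eo_le) _.
rewrite -ge0_integralD//; last 4 first.
- by move=> x _; rewrite lee_fin sqr_ge0.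
- by apply: mE; exact: measurable_funX.
- by move=> x _; rewrite lee_fin.
- exact: mE.
by under [leRHS]eq_integral do rewrite big_ord_recl EFinD.
Qed.

Lemma ge0_integral_gauss2D n (K L : 'rV[R]_n * 'rV[R]_n -> \bar R) :
  measurable_fun setT K -> measurable_fun setT L ->
  (forall p, 0 <= K p) -> (forall p, 0 <= L p) ->
  \int[gauss R n]_x \int[gauss R n]_y K (x, y) +
  \int[gauss R n]_x \int[gauss R n]_y L (x, y) =
  \int[gauss R n]_x \int[gauss R n]_y (K (x, y) + L (x, y)).
Proof.
move=> mK mL K0 L0; rewrite -ge0_integralD//; last 4 first.
- by move=> z _; exact: integral_ge0.
- exact: (measurable_fun_fubini_tonelli_F K).
- by move=> z _; exact: integral_ge0.
- exact: (measurable_fun_fubini_tonelli_F L).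
apply: eq_integral => z _; rewrite -ge0_integralD//.
- by apply: (measurableT_comp mK); exact: measurable_pair1.
- by apply: (measurableT_comp mL); exact: measurable_pair1.
Qed.

Lemma ge0_le_integral_gauss2 n (K L : 'rV[R]_n * 'rV[R]_n -> \bar R) :
  measurable_fun setT K -> measurable_fun setT L ->
  (forall p, 0 <= K p) -> (forall p, 0 <= L p) ->
  (forall x, \int[gauss R n]_y K (x, y) <= \int[gauss R n]_y L (x, y)) ->
  \int[gauss R n]_x \int[gauss R n]_y K (x, y) <=
  \int[gauss R n]_x \int[gauss R n]_y L (x, y).
Proof.
move=> mK mL K0 L0 KL; apply: ge0_le_integral => //.
- by move=> x _; exact: integral_ge0.
- exact: (measurable_fun_fubini_tonelli_F K).
- exact: (measurable_fun_fubini_tonelli_F L).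
Qed.

Lemma ge0_le_integral_gauss2_swap n (K L : 'rV[R]_n * 'rV[R]_n -> \bar R) :
  measurable_fun setT K -> measurable_fun setT L ->
  (forall p, 0 <= K p) -> (forall p, 0 <= L p) ->
  (forall y, \int[gauss R n]_x K (x, y) <= \int[gauss R n]_x L (x, y)) ->
  \int[gauss R n]_x \int[gauss R n]_y K (x, y) <=
  \int[gauss R n]_x \int[gauss R n]_y L (x, y).
Proof.
move=> mK mL K0 L0 KL.
rewrite (fubini_tonelli K mK K0) (fubini_tonelli L mL L0).
apply: ge0_le_integral => //.
- by move=> x _; exact: integral_ge0.
- exact: (measurable_fun_fubini_tonelli_G K).
- exact: (measurable_fun_fubini_tonelli_G L).
Qed.

Lemma ge0_integral_gauss_fstD_snd n (G : 'rV[R]_n -> R) :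
  measurable_fun setT G -> (forall x, (0 <= G x)%R) ->
  \int[gauss R n]_x \int[gauss R n]_y (G x + G y)%:E =
  \int[gauss R n]_x (G x)%:E + \int[gauss R n]_x (G x)%:E.
Proof.
move=> mG G0.
have mGE : measurable_fun setT (EFin \o G) by exact/measurable_EFinP.
have E x : \int[gauss R n]_y (G x + G y)%:E =
    (G x)%:E + \int[gauss R n]_y (G y)%:E.
  under eq_integral do rewrite EFinD.
  rewrite ge0_integralD//; last 2 first.
  - by move=> y _; rewrite lee_fin.
  - by move=> y _; rewrite lee_fin.
  by rewrite integral_cst// [X in _ * X]probability_setT mule1.
under eq_integral do rewrite E.
have I0 : 0 <= \int[gauss R n]_y (G y)%:E.
  by apply: integral_ge0 => y _; rewrite lee_fin.
rewrite ge0_integralD//; last by move=> y _; rewrite lee_fin.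
by rewrite integral_cst// [X in _ * X]probability_setT mule1.
Qed.

(** The rotated difference F(z, w) = f((w + z) / sqrt 2) - f((w - z) / sqrt 2)
    of an even f is odd in z and odd in w, so the mean square of F is at most
    that of its gradient in z, and also at most that of its gradient in w. The
    sum of the two squared gradients is |grad f|^2 at one point plus
    |grad f|^2 at the other, whose mean is twice the right-hand side. The left-hand
    side being twice the variance, this improves on the general Poincare
    inequality by a factor 2. *)
Lemma poincare_even n (f : 'rV[R]_n -> R) df : C1 f df ->
  (forall x, f (- x) = f x)%R ->
  \int[gauss R n]_x \int[gauss R n]_y ((f x - f y) ^+ 2)%:E <=
  \int[gauss R n]_x (\sum_(i < n) df i x ^+ 2)%:E.
Proof.
move=> Cf feven; have [mf mdf] := measurable_C1 Cf.
pose V := 'rV[R]_n.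
pose s : R := ((Num.sqrt 2)^-1)%R.
have ss : (s ^+ 2 = 2^-1)%R by rewrite exprVn sqr_sqrtr.
pose F (p : V * V) : R := (f (eighth_turn p).1 - f (eighth_turn p).2)%R.
have m1 (h : V -> R) : measurable_fun setT h ->
    measurable_fun setT (fun p : V * V => h p.1).
  by move=> mh; apply: (measurableT_comp mh).
have m2 (h : V -> R) : measurable_fun setT h ->
    measurable_fun setT (fun p : V * V => h p.2).
  by move=> mh; apply: (measurableT_comp mh).
have mrot (h : V * V -> R) : measurable_fun setT h ->
    measurable_fun setT (fun p => h (eighth_turn p)).
  by move=> mh; apply: (measurableT_comp mh); exact: measurable_eighth_turn.
pose D (p : V * V) : R := (\sum_(i < n) (df i p.1 - df i p.2) ^+ 2)%R.
pose S (p : V * V) : R := (\sum_(i < n) (df i p.1 + df i p.2) ^+ 2)%R.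
have mD : measurable_fun setT D.
  apply: measurable_sum => i; apply: measurable_funX.
  by apply: measurable_funB; [exact: m1|exact: m2].
have mS : measurable_fun setT S.
  apply: measurable_sum => i; apply: measurable_funX.
  by apply: measurable_funD; [exact: m1|exact: m2].
have D0 p : (0 <= D p)%R by exact: sum_sqr_ge0.
have S0 p : (0 <= S p)%R by exact: sum_sqr_ge0.
have mF : measurable_fun setT (fun p => (F p ^+ 2)%:E).
  apply/measurable_EFinP; apply: measurable_funX.
  apply: measurable_funB; first exact: (mrot _ (m1 _ mf)).
  exact: (mrot _ (m2 _ mf)).
pose I := \int[gauss R n]_x \int[gauss R n]_y ((f x - f y) ^+ 2)%:E.
have IE : I = \int[gauss R n]_z \int[gauss R n]_w (F (z, w) ^+ 2)%:E.
  rewrite /I (ge0_integral_gauss_eighth_turn (K := fun p => ((f p.1 - f p.2) ^+ 2)%:E))//.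
    apply/measurable_EFinP; apply: measurable_funX.
    by apply: measurable_funB; [exact: m1|exact: m2].
  by move=> p; rewrite lee_fin sqr_ge0.
pose D' p := (2^-1 * D (eighth_turn p))%R.
pose S' p := (2^-1 * S (eighth_turn p))%R.
have mD' : measurable_fun setT (EFin \o D').
  by apply/measurable_EFinP; apply: measurable_funM => //; exact: mrot.
have mS' : measurable_fun setT (EFin \o S').
  by apply/measurable_EFinP; apply: measurable_funM => //; exact: mrot.
have D'0 p : 0 <= (EFin \o D') p by rewrite lee_fin mulr_ge0.
have S'0 p : 0 <= (EFin \o S') p by rewrite lee_fin mulr_ge0.
have F0 p : 0 <= (F p ^+ 2)%:E by rewrite lee_fin sqr_ge0.
have leD : I <= \int[gauss R n]_z \int[gauss R n]_w (D' (z, w))%:E.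
  rewrite IE; apply: (ge0_le_integral_gauss2 mF mD' F0 D'0).
  move=> z.
  have C := C1_comb 1 (-1) (C1_affine s (s *: z)%R Cf) (C1_affine s (- (s *: z))%R Cf).
  have FE w : F (z, w) = (1 * f (s *: w + s *: z) + -1 * f (s *: w - s *: z))%R.
    by rewrite /F /eighth_turn/= -/s scalerDr scalerBr mul1r mulN1r.
  under eq_integral do rewrite FE.
  apply: le_trans (poincare_odd C _) _.
    move=> w; rewrite !scalerN.
    rewrite (_ : - (s *: w) + s *: z = - (s *: w - s *: z))%R; last first.
      by rewrite opprB addrC.
    by rewrite -opprD !feven; ring.
  rewrite le_eqVlt; apply/orP; left; apply/eqP.
  apply: eq_integral => w _; rewrite /comp /D' /D mulr_sumr; congr EFin.
  apply: eq_bigr => i _; rewrite /eighth_turn/= -/s scalerDr scalerBr -ss.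
  by ring.
have leS : I <= \int[gauss R n]_z \int[gauss R n]_w (S' (z, w))%:E.
  rewrite IE; apply: (ge0_le_integral_gauss2_swap mF mS' F0 S'0).
  move=> w.
  have C := C1_comb 1 (-1) (C1_affine s (s *: w)%R Cf) (C1_affine (- s) (s *: w)%R Cf).
  have FE z : F (z, w) = (1 * f (s *: z + s *: w) + -1 * f (- s *: z + s *: w))%R.
    rewrite /F /eighth_turn/= -/s scalerDr scalerBr mul1r mulN1r scaleNr.
    by rewrite (addrC (s *: w)%R) (addrC (s *: w)%R).
  under eq_integral do rewrite FE.
  apply: le_trans (poincare_odd C _) _.
    by move=> z; rewrite !scalerN !scaleNr opprK; ring.
  rewrite le_eqVlt; apply/orP; left; apply/eqP.
  apply: eq_integral => z _; rewrite /comp /S' /S mulr_sumr; congr EFin.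
  apply: eq_bigr => i _; rewrite /eighth_turn/= -/s scalerDr scalerBr scaleNr.
  rewrite (addrC (s *: w)%R) (addrC (s *: w)%R) -ss.
  by ring.
pose G x : R := (\sum_(i < n) df i x ^+ 2)%R.
have mG : measurable_fun setT G by exact: measurable_sum_sqr.
have G0 x : (0 <= G x)%R by exact: sum_sqr_ge0.
have mGG : measurable_fun setT (fun p : V * V => (G p.1 + G p.2)%:E).
  by apply/measurable_EFinP; apply: measurable_funD; [exact: m1|exact: m2].
have DS : \int[gauss R n]_z \int[gauss R n]_w (D' (z, w))%:E +
          \int[gauss R n]_z \int[gauss R n]_w (S' (z, w))%:E =
          \int[gauss R n]_x (G x)%:E + \int[gauss R n]_x (G x)%:E.
  pose T p := (G p.1 + G p.2)%R.
  rewrite -ge0_integral_gauss_fstD_snd//.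
  rewrite (ge0_integral_gauss_eighth_turn (K := EFin \o T))//; last first.
    by move=> p; rewrite lee_fin addr_ge0.
  apply: etrans; first exact: (ge0_integral_gauss2D mD' mS' D'0 S'0).
  apply: eq_integral => z _; apply: eq_integral => w _.
  rewrite -EFinD; congr EFin.
  rewrite /D' /S' /D /S /T /G -mulrDr -!big_split/= mulr_sumr.
  by apply: eq_bigr => i _; field.
have I0 : 0 <= I.
  by apply: integral_ge0 => x _; apply: integral_ge0 => y _; rewrite lee_fin sqr_ge0.
have IG0 : 0 <= \int[gauss R n]_x (G x)%:E.
  by apply: integral_ge0 => x _; rewrite lee_fin.
by apply: (lee_double I0 IG0); rewrite -DS; exact: leeD.
Qed.

End poincare.

(** * Integration of compactly supported functions *)

Section lebesgue_calculus.
Variables (R : realType) (n : nat).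
Local Notation V := 'rV[R]_n.
Local Notation Leb := (lebesgue_rV R n).

Lemma continuous_bounded_ball (W : V -> R) (M : R) : continuous W ->
  exists2 B, 0 <= B & forall x, `|x| <= M -> `|W x| <= B.
Proof.
move=> cW; pose K := [set x : V | `|x| <= M].
have cK : compact K.
  apply: bounded_closed_compact.
    by exists M; split; [exact: num_real|move=> r Mr x /= /le_trans; apply; exact: ltW].
  rewrite (_ : K = (fun x : V => `|x|) @^-1` [set r | r <= M])//.
  by apply: closed_comp; [move=> x _; exact: norm_continuous|exact: closed_le].
have : compact (W @` K).
  by apply: continuous_compact => //; exact: continuous_subspaceT.
move=> /compact_bounded[B [_ HB]]; exists (`|B| + 1); first by rewrite addr_ge0.
move=> x xM; apply: HB; last by exists x.
by rewrite (le_lt_trans (ler_norm _))// ltrDl.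
Qed.

Lemma gauss_pdf_gt0 (x : V) : 0 < gauss_pdf x.
Proof. by rewrite mulr_gt0 ?expR_gt0// powR_gt0// mulr_gt0// pi_gt0. Qed.

Lemma is_derive_gauss_pdf (x : V) i :
  is_derive x (delta_mx ord0 i) (@gauss_pdf R n) (- x ord0 i * gauss_pdf x).
Proof.
apply/is_derive_line.
pose c : R := (2 * pi) `^ (- (n%:R / 2)).
pose q t : R := - (enorm x ^+ 2 / 2) - x ord0 i * t - t ^+ 2 / 2.
have qE : (fun t : R => gauss_pdf (t *: delta_mx ord0 i + x)) = c \*: (expR \o q).
  apply/funext => t; rewrite /gauss_pdf -/c -[RHS]/(_ * _); congr (_ * expR _).
  rewrite /q /enorm !sqr_sqrtr ?dot_ge0// /dot.
  rewrite (bigD1 i)//= [in RHS](bigD1 i)//= !mxE !eqxx/=.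
  rewrite (eq_bigr (fun j => x ord0 j * x ord0 j)); first by field.
  by move=> j ji; rewrite !mxE (negbTE ji) mulr0 add0r.
have dq : is_derive (0 : R) (1 : R) q (- x ord0 i).
  have h1 := is_deriveZ (- x ord0 i) (is_derive_id (0 : R) (1 : R)).
  have h2 := is_deriveZ (- 2^-1) (is_deriveX 2 (is_derive_id (0 : R) (1 : R))).
  have h0 := is_derive_cst (- (enorm x ^+ 2 / 2)) (0 : R) (1 : R).
  have := is_deriveD h0 (is_deriveD h1 h2).
  rewrite (_ : _ + _ = q); last first.
    apply/funext => t.
    rewrite -[LHS]/(- (enorm x ^+ 2 / 2) + (- x ord0 i * t + - 2^-1 * t ^+ 2)) /q.
    by field.
  move=> h; apply: (is_derive_eq h).
  rewrite -![_ *: _]/(_ * _) -[id 0]/(0 : R); ring.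
have d1 := is_derive1_comp (is_derive_expR (q 0)) dq.
rewrite qE; apply: (is_derive_eq (is_deriveZ c d1)).
rewrite -[_ *: _]/(_ * _) /gauss_pdf -/c /q mulr0 expr0n mul0r !subr0.
by rewrite mulrA mulrC.
Qed.

Lemma continuous_rV_coord i : continuous (fun x : V => x ord0 i).
Proof. exact: coord_continuous. Qed.

Lemma continuous_gauss_pdf : continuous (@gauss_pdf R n).
Proof.
rewrite (_ : @gauss_pdf R n = fun x : V => (2 * pi) `^ (- (n%:R / 2)) *
    expR (\sum_(i < n) (- 2^-1) * x ord0 i ^+ 2)).
  apply: contM; first exact: cont_cst.
  apply: (cont_comp (f := expR)); last exact: continuous_expR.
  apply: cont_sum => i; apply: contM; first exact: cont_cst.
  by apply: contX; exact: continuous_rV_coord.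
apply/funext => x; rewrite /gauss_pdf; congr (_ * expR _).
rewrite /enorm sqr_sqrtr ?dot_ge0// /dot -mulr_sumr mulNr mulrC.
by congr (- (_ * _)); apply: eq_bigr => i _; rewrite expr2.
Qed.

Lemma C1_gauss_pdf : C1 (@gauss_pdf R n) (fun i x => - x ord0 i * gauss_pdf x).
Proof.
split; first exact: continuous_gauss_pdf.
move=> i; split; last by move=> x; exact: is_derive_gauss_pdf.
apply: contM; last exact: continuous_gauss_pdf.
rewrite (_ : (fun _ => _) = fun x : V => (-1) * x ord0 i); last first.
  by apply/funext => x; rewrite mulN1r.
by apply: contM; [exact: cont_cst|exact: continuous_rV_coord].
Qed.

(** Local finiteness of Lebesgue measure, in the form used below: the density
    of the Gaussian measure is bounded below on bounded sets. *)
Lemma integrable_bounded_support (f : V -> R) (M B : R) :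
  measurable_fun setT f -> (forall x, `|f x| <= B) ->
  (forall x, M < `|x| -> f x = 0) -> Leb.-integrable setT (EFin \o f).
Proof.
move=> mf fB fM.
have [B' B'0 HB'] : exists2 B', 0 <= B' &
    forall x : V, `|x| <= M -> `|(gauss_pdf x)^-1| <= B'.
  apply: continuous_bounded_ball => x.
  apply: (@continuousV _ V); first by rewrite gt_eqF// gauss_pdf_gt0.
  exact: continuous_gauss_pdf.
have mq : measurable_fun setT (fun x => (`|f x| / gauss_pdf x)%:E).
  apply/measurable_EFinP; apply: measurable_funM; first exact: measurableT_comp.
  apply: continuous_measurable_rV => x.
  apply: (@continuousV _ V); first by rewrite gt_eqF// gauss_pdf_gt0.
  exact: continuous_gauss_pdf.
have q0 x : (0 <= (`|f x| / gauss_pdf x)%:E)%E.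
  by rewrite lee_fin divr_ge0// gauss_pdf_ge0.
apply/integrableP; split; first exact/measurable_EFinP.
have -> : (\int[Leb]_x `|(EFin \o f) x| =
           \int[gauss R n]_x (`|f x| / gauss_pdf x)%:E)%E.
  rewrite ge0_integral_gauss//; apply: eq_integral => x _.
  by rewrite -EFinM divfK// gt_eqF// gauss_pdf_gt0.
apply: (@le_lt_trans _ _ (\int[gauss R n]_x (B * B')%:E)%E).
  have B0 : 0 <= B by apply: le_trans (fB 0).
  apply: ge0_le_integral => //.
  move=> x _; rewrite lee_fin; have [xM|Mx] := leP `|x| M.
    apply: ler_pM => //; first by rewrite invr_ge0 gauss_pdf_ge0.
    by apply: le_trans (HB' _ xM); exact: ler_norm.
  by rewrite fM// normr0 mul0r mulr_ge0.
by rewrite integral_cst// [X in (_ * X)%E]probability_setT mule1 ltry.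
Qed.

Definition compactly_supported (f : V -> R) :=
  continuous f /\ exists M, forall x, M < `|x| -> f x = 0.

Lemma csuppM (f g : V -> R) : compactly_supported f -> continuous g ->
  compactly_supported (fun x => f x * g x).
Proof.
move=> [cf [M fM]] cg; split; first exact: contM.
by exists M => x Mx; rewrite fM// mul0r.
Qed.

Lemma csuppMl (f g : V -> R) : continuous f -> compactly_supported g ->
  compactly_supported (fun x => f x * g x).
Proof.
move=> cf [cg [M gM]]; split; first exact: contM.
by exists M => x Mx; rewrite gM// mulr0.
Qed.

Lemma csuppD (f g : V -> R) : compactly_supported f -> compactly_supported g ->
  compactly_supported (fun x => f x + g x).
Proof.
move=> [cf [M fM]] [cg [M' gM]]; split; first exact: contD.
exists (Num.max M M') => x; rewrite gt_max => /andP[h1 h2].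
by rewrite fM// gM// addr0.
Qed.

Lemma csupp_sum m (f : 'I_m -> V -> R) : (forall i, compactly_supported (f i)) ->
  compactly_supported (fun x => \sum_(i < m) f i x).
Proof.
elim: m f => [|m IH] f cf.
  under eq_fun do rewrite big_ord0.
  by split; [exact: cont_cst|exists 0].
under eq_fun do rewrite big_ord_recl.
by apply: csuppD; [exact: cf|apply: IH => i; exact: cf].
Qed.

Lemma csupp_shift (f : V -> R) (v : V) : compactly_supported f ->
  compactly_supported (fun x => f (x + v)).
Proof.
move=> [cf [M fM]]; split.
  apply: (@cont_comp _ _ _ (fun x : V => x + v) f) => //.
  rewrite (_ : (fun x => _) = (fun x : V => 1 *: x + v)); last first.
    by apply/funext => x; rewrite scale1r.
  exact: continuous_affine_map.
exists (M + `|v|) => x h; apply: fM; rewrite -ltrBrDr in h.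
by apply: lt_le_trans h _; have := lerB_dist x (- v); rewrite opprK normrN.
Qed.

Lemma csupp_integrable (f : V -> R) : compactly_supported f ->
  Leb.-integrable setT (EFin \o f).
Proof.
move=> [cf [M fM]]; have [B B0 HB] := continuous_bounded_ball M cf.
apply: (integrable_bounded_support (M := M) (B := B)) => //.
  exact: continuous_measurable_rV.
move=> x; have [/HB//|Mx] := leP `|x| M.
by rewrite fM// normr0.
Qed.

Local Notation I f := (\int[Leb]_x f x)%R.

Lemma LebD (f g : V -> R) : compactly_supported f -> compactly_supported g ->
  I (fun x => f x + g x) = I f + I g.
Proof. by move=> cf cg; apply: RintegralD => //; exact: csupp_integrable. Qed.

Lemma LebZ k (f : V -> R) : compactly_supported f -> I (fun x => k * f x) = k * I f.
Proof. by move=> cf; apply: RintegralZl => //; exact: csupp_integrable. Qed.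

Lemma LebB (f g : V -> R) : compactly_supported f -> compactly_supported g ->
  I (fun x => f x - g x) = I f - I g.
Proof. by move=> cf cg; apply: RintegralB => //; exact: csupp_integrable. Qed.

Lemma Leb_sum m (f : 'I_m -> V -> R) : (forall i, compactly_supported (f i)) ->
  I (fun x => \sum_(i < m) f i x) = \sum_(i < m) I (f i).
Proof.
elim: m f => [|m IH] f cf.
  under eq_Rintegral do rewrite big_ord0.
  by rewrite big_ord0 Rintegral_cst// mul0r.
under eq_Rintegral do rewrite big_ord_recl.
rewrite big_ord_recl -IH//; apply: LebD; first exact: cf.
exact: csupp_sum.
Qed.

Lemma Leb_shift (f : V -> R) (v : V) : measurable_fun setT f ->
  I (fun x => f (x + v)) = I f.
Proof.
move=> mf; have mfE : measurable_fun setT (EFin \o f) by exact/measurable_EFinP.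
have H (h : V -> \bar R) : measurable_fun setT h -> (forall x, 0 <= h x)%E ->
    (\int[Leb]_x h (x + v)%R = \int[Leb]_x h x)%E.
  move=> mh h0; rewrite [RHS](ge0_integral_lebesgue_rV_affine v (a := 1))//.
  rewrite normr1 expr1n mul1e; apply: eq_integral => x _; by rewrite scale1r.
congr fine; rewrite integralE [RHS]integralE; congr (_ - _)%E.
- have mp : measurable_fun setT ((EFin \o f)^\+)%E by exact: measurable_funepos.
  rewrite -[RHS](H _ mp (funepos_ge0 _)).
  by apply: eq_integral => x _; rewrite !funeposE.
- have mp : measurable_fun setT ((EFin \o f)^\-)%E by exact: measurable_funeneg.
  rewrite -[RHS](H _ mp (funeneg_ge0 _)).
  by apply: eq_integral => x _; rewrite !funenegE.
Qed.

Lemma Rintegral_gauss (f : V -> R) : measurable_fun setT f ->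
  \int[gauss R n]_x f x = I (fun x => f x * gauss_pdf x).
Proof.
move=> mf; have mfE : measurable_fun setT (EFin \o f) by exact/measurable_EFinP.
congr fine; rewrite integralE [RHS]integralE; congr (_ - _)%E.
- rewrite ge0_integral_gauss//; last exact: measurable_funepos.
  apply: eq_integral => x _; rewrite !funeposE /= -EFin_max -EFin_max -EFinM.
  by rewrite maxr_pMl ?gauss_pdf_ge0// mul0r.
- rewrite ge0_integral_gauss//; last exact: measurable_funeneg.
  apply: eq_integral => x _; rewrite !funenegE /= -EFin_max -EFin_max -EFinM.
  by rewrite maxr_pMl ?gauss_pdf_ge0// mul0r mulNr.
Qed.

End lebesgue_calculus.

(** * The Gaussian divergence of a truncated vector field *)

Section divergence.
Variables (R : realType) (n : nat).
Local Notation V := 'rV[R]_n.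
Local Notation Leb := (lebesgue_rV R n).
Local Notation rho := (@gauss_pdf R n).
Local Notation e_ i := (delta_mx ord0 i : V).
Local Notation I f := (\int[Leb]_x f x)%R.
Local Notation csupp := (@compactly_supported R n).

Lemma cvg_sum_ord m (a : 'I_m -> nat -> R) (l : 'I_m -> R) :
  (forall i, a i k @[k --> \oo] --> l i) ->
  \sum_(i < m) a i k @[k --> \oo] --> \sum_(i < m) l i.
Proof.
elim: m a l => [|m IH] a l al.
  by rewrite big_ord0; under eq_fun do rewrite big_ord0; exact: cvg_cst.
rewrite big_ord_recl; under eq_fun do rewrite big_ord_recl.
by apply: cvgD; [exact: al|apply: IH => i; exact: al].
Qed.

Lemma mean_value_dir (F dF : V -> R) (v x : V) (h : R) :
  (forall y, is_derive y v F (dF y)) -> 0 <= h ->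
  exists2 t, 0 <= t <= h & F (x + h *: v) - F x = h * dF (x + t *: v).
Proof.
move=> dFF h0.
have D (t : R) : is_derive t (1 : R) (fun s : R => F (x + s *: v)) (dF (x + t *: v)).
  apply/(is_derive_affine (A := fun s : R => x + s *: v) F (w := v)) => k.
  by rewrite scalerDl -[k *: 1]/(k * 1) mulr1 addrCA.
have [|t] := @MVT_segment R _ _ _ _ h0 (fun t _ => D t).
  apply: continuous_subspaceT => t.
  by apply/differentiable_continuous/derivable1_diffP; case: (D t).
rewrite in_itv/= => th; rewrite scale0r addr0 subr0 mulrC => E.
by exists t.
Qed.

(** Derivatives are limits over all small nonzero steps, whereas dominated
    convergence is about sequences; the steps 1 / (k + 1) connect the two. *)
Lemma harmonic_dnbhs : (fun k => k.+1%:R^-1 : R) @ \oo --> (0 : R)^'.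
Proof.
move=> A [e /= e0 HA].
have [N _ HN] := near_infty_natSinv_lt (PosNum e0).
exists N => // k /= Nk; apply: HA => /=; last by rewrite gt_eqF// invr_gt0.
by rewrite sub0r normrN ger0_norm ?invr_ge0//; exact: HN.
Qed.

Lemma difference_quotient_cvg (F : V -> R) (x v : V) (d : R) :
  is_derive x v F d ->
  (k.+1%:R * (F (x + k.+1%:R^-1 *: v) - F x)) @[k --> \oo] --> d.
Proof.
move=> [dF <-]; have /cvg_ex[l hl] := dF.
have -> : 'D_v F x = l by rewrite /derive; apply/cvg_lim.
have := cvg_comp _ _ harmonic_dnbhs hl.
rewrite (_ : _ \o _ = fun k : nat => k.+1%:R * (F (x + k.+1%:R^-1 *: v) - F x))//.
by apply/funext => k /=; rewrite invrK -[LHS]/(_ * _) (addrC x).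
Qed.

Lemma cont_shift (F : V -> R) (v : V) : continuous F ->
  continuous (fun x : V => F (x + v)).
Proof.
move=> cF; apply: (@cont_comp _ _ _ (fun x : V => x + v) F) => //.
rewrite (_ : (fun x => _) = (fun x : V => 1 *: x + v)); last first.
  by apply/funext => x; rewrite scale1r.
exact: continuous_affine_map.
Qed.

(** By the mean value theorem the difference quotients are bounded by the
    supremum of dF on a ball, so dominated convergence applies. The support
    condition is on the product: it is met when W has compact support, and also
    when F does, and both cases occur. *)
Lemma Leb_difference_quotient (W F dF : V -> R) (v : V) (M : R) :
  continuous W -> continuous F -> continuous dF ->
  (forall x, is_derive x v F (dF x)) ->
  (forall x h, 0 <= h <= 1 -> M < `|x| -> W x * (F (x + h *: v) - F x) = 0) ->
  (k.+1%:R * I (fun x => W x * (F (x + k.+1%:R^-1 *: v) - F x))) @[k --> \oo]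
    --> I (fun x => W x * dF x).
Proof.
move=> cW cF cdF dFF supp.
have [BW BW0 HW] := continuous_bounded_ball M cW.
have [BF BF0 HF] := continuous_bounded_ball (M + `|v|) cdF.
pose h (k : nat) : R := k.+1%:R^-1.
have h01 k : 0 <= h k <= 1.
  by rewrite invr_ge0 ler0n/= invf_le1 ?ltr0n// ler1n.
pose q k x := k.+1%:R * (W x * (F (x + h k *: v) - F x)).
have cq k : continuous (q k).
  apply: contM; first exact: cont_cst.
  apply: contM => //; apply: contB => //.
  exact: cont_shift.
have q0 k x : M < `|x| -> q k x = 0 by move=> Mx; rewrite /q supp// mulr0.
have qB k x : `|q k x| <= BW * BF.
  have [xM|/q0->] := leP `|x| M; last by rewrite normr0 mulr_ge0.
  have /andP[hk0 hk1] := h01 k.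
  have [t /andP[t0 th] E] := mean_value_dir x dFF hk0.
  rewrite /q E mulrCA [_ * (h k * _)]mulrA divff ?pnatr_eq0// mul1r normrM.
  apply: ler_pM => //; first exact: HW.
  apply: HF; apply: le_trans (ler_normD _ _) _; apply: lerD => //.
  by rewrite normrZ ger0_norm// ler_piMl// (le_trans th).
have qc x : q k x @[k --> \oo] --> W x * dF x.
  rewrite (_ : q^~ x = fun k => W x * (k.+1%:R * (F (x + h k *: v) - F x))).
    by apply: cvgM; [exact: cvg_cst|exact: difference_quotient_cvg].
  by apply/funext => k; rewrite /q mulrCA.
have mq k : measurable_fun setT (q k) by exact: continuous_measurable_rV.
have mWF : measurable_fun setT (fun x => W x * dF x).
  by apply: continuous_measurable_rV; exact: contM.
pose g x : R := BW * BF * \1_[set x : V | `|x| <= M] x.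
have mball : measurable [set x : V | `|x| <= M].
  have -> : [set x : V | `|x| <= M] =
    setT `&` (fun x : V => `|x|) @^-1` `]-oo, M]%classic.
    by rewrite setTI; apply/seteqP; split => x /=; rewrite in_itv.
  apply: continuous_measurable_rV => //; exact: norm_continuous.
have ig : Leb.-integrable setT (EFin \o g).
  apply: (integrable_bounded_support (M := M) (B := BW * BF)).
  - by apply: measurable_funM.
  - move=> x; rewrite /g indicE; case: (_ \in _);
      rewrite ?mulr1 ?mulr0 ?normr0 ?mulr_ge0//.
    by rewrite ger0_norm// mulr_ge0.
  - by move=> x Mx; rewrite /g indicE memNset ?mulr0//= => /le_lt_trans/(_ Mx);
      rewrite ltxx.
have qg k x : `|q k x| <= g x.
  rewrite /g indicE; have [xM|Mx] := leP `|x| M.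
    by rewrite mem_set// mulr1.
  by rewrite q0// normr0 mulr_ge0// mulr_ge0.
have qcE x : (q k x)%:E @[k --> \oo] --> (W x * dF x)%:E.
  by apply: cvg_EFin; [exact: nearW|exact: qc].
have [iWF _ cI] := @dominated_convergence _ V R Leb setT measurableT
  (fun k x => (q k x)%:E) (fun x => (W x * dF x)%:E) (EFin \o g)
  (fun k => (measurable_EFinP _ _).2 (mq k)) ((measurable_EFinP _ _).2 mWF)
  (aeW _ (fun x _ => qcE x)) ig
  (aeW _ (fun x k _ => qg k x)).
have iq k : Leb.-integrable setT (EFin \o q k).
  apply: csupp_integrable; split; first exact: cq.
  by exists M => x; exact: q0.
have E k : k.+1%:R * I (fun x => W x * (F (x + h k *: v) - F x)) = I (q k).
  rewrite /q LebZ//; split; last by exists M => x Mx; rewrite supp.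
  by apply: contM => //; apply: contB => //; exact: cont_shift.
under eq_fun do rewrite E.
apply: fine_cvg; rewrite fineK; last exact: integrable_fin_num.
exact: cI.
Qed.

Lemma csupp_difference (W F : V -> R) (v : V) : csupp F -> exists M : R,
  forall x h, 0 <= h <= 1 -> M < `|x| -> W x * (F (x + h *: v) - F x) = 0.
Proof.
move=> [cF [M FM]]; exists (M + `|v|) => x h /andP[h0 h1] Mx.
have hv : `|h *: v| <= `|v| by rewrite normrZ ger0_norm// ler_piMl.
have a : M < `|x| by apply: le_lt_trans Mx; rewrite lerDl.
have b : M < `|x + h *: v|.
  have := lerB_dist x (- (h *: v)); rewrite opprK normrN => c.
  apply: lt_le_trans c; rewrite ltrBrDr; apply: le_lt_trans Mx.
  by rewrite lerD2l.
by rewrite !FM// subrr mulr0.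
Qed.

(** The integrals of the difference quotients vanish by translation invariance. *)
Lemma Leb_derive_eq0 (F : V -> R) dF i : csupp F -> C1 F dF -> I (dF i) = 0.
Proof.
move=> sF [cF /(_ i)[cdF dFF]].
have [M HM] := csupp_difference (fun _ => 1) (e_ i) sF.
have := Leb_difference_quotient (@cont_cst R V 1) cF cdF dFF HM.
under eq_fun => k.
  have -> : I (fun x => 1 * (F (x + k.+1%:R^-1 *: e_ i) - F x)) = 0.
    under eq_Rintegral do rewrite mul1r.
    rewrite LebB//; last exact: csupp_shift.
    by rewrite Leb_shift ?subrr//; exact: continuous_measurable_rV.
  rewrite mulr0; over.
rewrite (_ : I (fun x => 1 * dF i x) = I (dF i)); last first.
  by apply: eq_Rintegral => x _; rewrite mul1r.
by move=> H; rewrite -(cvg_lim _ H)//; exact: lim_cst.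
Qed.

Lemma C1_shift (F : V -> R) dF (v : V) : C1 F dF ->
  C1 (fun x => F (x + v)) (fun i x => dF i (x + v)).
Proof.
move=> [cF H]; split=> [|i]; first exact: cont_shift.
have [cd dd] := H i; split=> [|x]; first exact: cont_shift.
apply/(is_derive_affine (A := fun x => x + v) F (w := e_ i)) => k.
by rewrite addrA.
Qed.

Lemma csupp_derive (g : V -> R) dg i : csupp g -> C1 g dg -> csupp (dg i).
Proof.
move=> [cg [M gM]] [_ /(_ i)[cdg dgg]]; split => //; exists M => x Mx.
have near0 : \forall y \near x, cst 0 y = g y.
  have : nbhs x [set y : V | M < `|y|].
    apply: open_nbhs_nbhs; split => //.
    rewrite (_ : [set y : V | M < `|y|] = (fun y : V => `|y|) @^-1` [set r | M < r])//.
    by apply: open_comp; [move=> y _; exact: norm_continuous|exact: open_gt].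
  by apply: filterS => y /= /gM ->.
have [_ d0] := near_eq_is_derive near0 (is_derive_cst (0 : R) x (e_ i)).
by have [_ <-] := dgg x.
Qed.

(** Integration by parts: the adjoint of the i-th partial derivative for the
    Gaussian weight is x_i - d/dx_i. *)
Lemma Leb_gauss_ibp (g u : V -> R) dg du i : csupp g -> C1 g dg -> C1 u du ->
  I (fun x => rho x * (g x * (du i x - x ord0 i * u x))) =
  - I (fun x => rho x * (dg i x * u x)).
Proof.
move=> sg Cg Cu; have [cu Hu] := Cu; have [cdu _] := Hu i.
have [cg Hg] := Cg; have [cdg dgg] := Hg i.
have cr := @continuous_gauss_pdf R n.
have cx := @continuous_rV_coord R n i.
have sdg := csupp_derive i sg Cg.
have CF := C1_mul (@C1_gauss_pdf R n) (C1_mul Cg Cu).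
have sF : csupp (fun x => rho x * (g x * u x)).
  by apply: csuppMl => //; exact: csuppM.
have := Leb_derive_eq0 i sF CF; move=> E0.
apply/eqP; rewrite -addr_eq0 -LebD.
- apply/eqP; rewrite -[RHS]E0; apply: eq_Rintegral => x _.
  by ring.
- apply: csuppMl => //; apply: csuppM => //; apply: contB => //.
  exact: contM.
- by apply: csuppMl => //; exact: csuppM.
Qed.

Section vector_field.
Variables (u : 'I_n -> V -> R) (H : 'I_n -> 'I_n -> V -> R).
Hypothesis Cu : forall j, C1 (u j) (fun i => H i j).
Variables (c : V -> R) (dc : 'I_n -> V -> R).
Hypothesis sc : csupp c.
Hypothesis Cc : C1 c dc.

(** The divergence adjoint to minus the gradient for the Gaussian weight. For
    u = grad eta it is laplacian eta x - dot (grad eta x) x. *)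
Definition gauss_div (x : V) : R := \sum_(j < n) (H j j x - x ord0 j * u j x).

Let cu j : continuous (u j). Proof. by have [] := Cu j. Qed.
Let cH i j : continuous (H i j). Proof. by have [_ /(_ i)[]] := Cu j. Qed.
Let cr : continuous rho. Proof. exact: continuous_gauss_pdf. Qed.
Let cx i : continuous (fun x : V => x ord0 i). Proof. exact: continuous_rV_coord. Qed.
Let cdc i : continuous (dc i). Proof. by have [_ /(_ i)[]] := Cc. Qed.
Let cc : continuous c. Proof. by have [] := Cc. Qed.
Let sdc i : csupp (dc i). Proof. exact: csupp_derive sc Cc. Qed.

Lemma continuous_gauss_div : continuous gauss_div.
Proof.
by apply: cont_sum => j; apply: contB => //; apply: contM.
Qed.

(* The coefficients x_j do not commute with translations; the last term is what
   this costs, and it produces the integral of u_i^2 in the next lemma. *)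
Let gauss_div_shift i (h : R) x : gauss_div (x - h *: e_ i) =
  \sum_(j < n) (H j j (x - h *: e_ i) - x ord0 j * u j (x - h *: e_ i))
  + h * u i (x - h *: e_ i).
Proof.
rewrite /gauss_div (bigD1 i)//= [in RHS](bigD1 i)//= !mxE !eqxx/= mulr1.
rewrite (eq_bigr (fun j => H j j (x - h *: e_ i) - x ord0 j * u j (x - h *: e_ i))).
  by ring.
by move=> j ji; rewrite !mxE (negbTE ji) mulr0 subr0.
Qed.

(* the j-th partial derivative of c u_i *)
Let dg i j x := dc j x * u i x + c x * H j i x.

(** The left-hand side integrates W = gauss_div against the i-th derivative of
    F = rho c u_i. If W were differentiable this would be minus the integral of
    F d_i W, with d_i W = gauss_div (d_i u) - u_i, and one more integration by
    parts, over the divergence, would give the right-hand side. As W is only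
    continuous, d_i F is approximated by difference quotients; a translation
    moves the difference onto W, and there onto u, whose difference is of class
    C^1. *)
Lemma gauss_div_ibp i :
  I (fun x => gauss_div x * (rho x * (dc i x * u i x + c x * (H i i x - x ord0 i * u i x)))) =
  I (fun x => rho x * (\sum_(j < n) H i j x * dg i j x)) +
  I (fun x => rho x * (c x * u i x ^+ 2)).
Proof.
pose F x := rho x * (c x * u i x).
pose dF x := rho x * (dc i x * u i x + c x * (H i i x - x ord0 i * u i x)).
have Cg := C1_mul Cc (Cu i).
have sg : csupp (fun x => c x * u i x) by exact: csuppM.
have CF := C1_mul (@C1_gauss_pdf R n) Cg.
have sF : csupp F by exact: csuppMl.
have cF : continuous F by have [] := sF.
have dFF x : is_derive x (e_ i) F (dF x).
  have [_ /(_ i)[_ /(_ x) h]] := CF.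
  by apply: (is_derive_eq h); rewrite /dF; ring.
have cdF : continuous dF.
  apply: contM => //; apply: contD; first exact: contM.
  by apply: contM => //; apply: contB => //; exact: contM.
have cW := continuous_gauss_div.
have cdg j : continuous (dg i j).
  by apply: contD; apply: contM.
have sdg j : csupp (dg i j).
  by apply: csuppD; apply: csuppM => //; exact: sdc.
have [M HM] := csupp_difference gauss_div (e_ i) sF.
have cvgL := Leb_difference_quotient cW cF cdF dFF HM.
pose h (k : nat) : R := k.+1%:R^-1.
have h01 k : 0 <= h k <= 1.
  by rewrite invr_ge0 ler0n/= invf_le1 ?ltr0n// ler1n.
(* difference quotients of u j in the direction - e_ i, against a compactly
   supported weight *)
have cvgD_ (w : V -> R) j : csupp w ->
    (k.+1%:R * I (fun x => w x * (u j (x - h k *: e_ i) - u j x))) @[k --> \oo]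
    --> - I (fun x => w x * H i j x).
  move=> sw; have [cw [N wN]] := sw.
  have cnH : continuous (fun x => -1 * H i j x) by apply: contM => //;
    exact: cont_cst.
  have dn x : is_derive x (- e_ i) (u j) (-1 * H i j x).
    have [_ /(_ i)[_ /(_ x) d]] := Cu j.
    by rewrite -scaleN1r; exact: is_derive_dirZ.
  have := @Leb_difference_quotient w (u j) _ (- e_ i) N cw (@cu j) cnH dn.
  rewrite (_ : I (fun x => w x * (-1 * H i j x)) = - I (fun x => w x * H i j x));
    last first.
    rewrite -[RHS]mulN1r -LebZ; last exact: csuppM.
    by apply: eq_Rintegral => x _; rewrite mulrCA.
  under eq_fun do under eq_Rintegral do rewrite scalerN.
  by apply => x k _ Nx; rewrite wN// mul0r.
pose Dj k j x := u j (x - h k *: e_ i) - u j x.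
have step k :
  k.+1%:R * I (fun x => gauss_div x * (F (x + h k *: e_ i) - F x)) =
  - (\sum_(j < n) k.+1%:R * I (fun x => (rho x * dg i j x) * Dj k j x)) +
  (I (fun x => F x * u i x) +
   h k * (k.+1%:R * I (fun x => F x * Dj k i x))).
  have kh : k.+1%:R * h k = 1 by rewrite divff ?pnatr_eq0.
  have CD j : C1 (Dj k j) (fun l x => 1 * H l j (x - h k *: e_ i) + -1 * H l j x).
    have := C1_comb 1 (-1) (C1_shift (- (h k *: e_ i)) (Cu j)) (Cu j).
    rewrite (_ : (fun z => _) = Dj k j)//.
    by apply/funext => x; rewrite /Dj mul1r mulN1r.
  have cD j : continuous (Dj k j) by have [] := CD j.
  pose W' x := gauss_div (x - h k *: e_ i).
  have cW' : continuous W' by exact: cont_shift.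
  have E1 : I (fun x => gauss_div x * (F (x + h k *: e_ i) - F x)) =
            I (fun x => F x * (W' x - gauss_div x)).
    under eq_Rintegral do rewrite mulrBr.
    rewrite LebB; last 2 first.
    - by apply: csuppMl => //; exact: csupp_shift.
    - exact: csuppMl.
    rewrite -(Leb_shift (- (h k *: e_ i))); last first.
      by apply: continuous_measurable_rV; apply: contM => //; exact: cont_shift.
    rewrite -LebB; last 2 first.
    - under eq_fun do rewrite subrK; exact: csuppMl.
    - exact: csuppMl.
    by apply: eq_Rintegral => x _; rewrite subrK -/(W' x) mulrBr mulrC [_ * F x]mulrC.
  have E2 x : F x * (W' x - gauss_div x) =
      (\sum_(j < n) rho x * (c x * u i x * ((1 * H j j (x - h k *: e_ i) + -1 * H j j x)
         - x ord0 j * Dj k j x))) + h k * (F x * u i x + F x * Dj k i x).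
    rewrite /W' gauss_div_shift addrAC mulrDr; congr (_ + _); last first.
      by rewrite /Dj; ring.
    rewrite /gauss_div -sumrB mulr_sumr; apply: eq_bigr => j _.
    by rewrite /F /Dj; ring.
  have sE j : csupp (fun x => rho x * (c x * u i x * ((1 * H j j (x - h k *: e_ i) + -1 * H j j x)
         - x ord0 j * Dj k j x))).
    apply: csuppMl => //; apply: csuppM => //; apply: contB; last exact: contM.
    by have [_ /(_ j)[]] := CD j.
  rewrite E1; under eq_Rintegral do rewrite E2.
  have sFu : csupp (fun x => F x * u i x) by exact: csuppM.
  have sFD : csupp (fun x => F x * Dj k i x) by exact: csuppM.
  rewrite LebD; last 2 first.
  - exact: csupp_sum.
  - by apply: csuppMl; [exact: cont_cst|exact: csuppD].
  rewrite Leb_sum// LebZ; last exact: csuppD.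
  rewrite LebD// mulrDr; congr (_ + _); last first.
    by rewrite [LHS]mulrA kh mul1r [h k * _]mulrA (mulrC (h k)) kh mul1r.
  rewrite mulr_sumr -sumrN; apply: eq_bigr => j _.
  rewrite (Leb_gauss_ibp j sg Cg (CD j)) mulrN; congr (- (_ * _)).
  by apply: eq_Rintegral => x _; rewrite mulrA.
have cvgR : (- (\sum_(j < n) k.+1%:R * I (fun x => (rho x * dg i j x) * Dj k j x)) +
  (I (fun x => F x * u i x) +
   h k * (k.+1%:R * I (fun x => F x * Dj k i x)))) @[k --> \oo] -->
   - (\sum_(j < n) - I (fun x => (rho x * dg i j x) * H i j x)) +
   (I (fun x => F x * u i x) + 0 * - I (fun x => F x * H i i x)).
  apply: cvgD.
    apply: cvgN; apply: cvg_sum_ord => j; apply: cvgD_; exact: csuppMl.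
  apply: cvgD; first exact: cvg_cst.
  apply: cvgM; last exact: cvgD_.
  exact: cvg_harmonic.
have -> : I (fun x => gauss_div x * (rho x * (dc i x * u i x + c x * (H i i x - x ord0 i * u i x))))
  = - (\sum_(j < n) - I (fun x => (rho x * dg i j x) * H i j x)) +
   (I (fun x => F x * u i x) + 0 * - I (fun x => F x * H i i x)).
  have : k.+1%:R * I (fun x => gauss_div x * (F (x + h k *: e_ i) - F x))
      @[k --> \oo] --> I (fun x => gauss_div x * dF x) by exact: cvgL.
  under eq_fun do rewrite step.
  by move=> cvgL'; exact: (cvg_unique _ cvgL' cvgR).
rewrite mul0r addr0 sumrN opprK -Leb_sum; last first.
  by move=> j; apply: csuppM => //; exact: csuppMl.
congr (_ + _); apply: eq_Rintegral => x _.
  by rewrite mulr_sumr; apply: eq_bigr => j _; ring.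
by rewrite /F; ring.
Qed.

End vector_field.
End divergence.

(** * Cutoff functions *)

Section cutoff.
Variables (R : realType) (n : nat).
Local Notation V := 'rV[R]_n.

(** Serves at the junction point of a function defined piecewise, where the
    rules of calculus do not apply. *)
Lemma is_derive_quadratic (f : R -> R) (x d : R) :
  (forall h, `|f (x + h) - f x - h * d| <= h ^+ 2) -> is_derive x 1 f d.
Proof.
move=> hf.
have H : (fun h : R => h^-1 *: ((f \o shift x) (h *: 1) - f x)) @ 0^' --> d.
  apply/cvgrPdist_le => e e0; near=> h.
  have h0 : h != 0 by near: h; exact: nbhs_dnbhs_neq.
  have he : `|h| <= e.
    by near: h; exact: dnbhs0_le.
  apply: le_trans he; rewrite /= -[h *: 1]/(h * 1) mulr1 (addrC h).
  rewrite -[_ *: _]/(_ * _) -(ler_pM2l (x := `|h|)) ?normr_gt0//.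
  rewrite -normrM -expr2 real_normK ?num_real//.
  rewrite mulrBr mulrA divff// mul1r -normrN opprB.
  exact: hf.
by apply: DeriveDef; [apply/cvg_ex; exists d|apply/cvg_lim].
Unshelve. all: by end_near. Qed.

(** The square makes the function of class C^1 at s = 1, where it reaches 0. *)
Definition bump (s : R) : R := Num.max 0 (1 - s) ^+ 2.

Lemma is_derive_bump (s : R) : is_derive s 1 bump (- 2 * Num.max 0 (1 - s)).
Proof.
apply: is_derive_quadratic => h; rewrite /bump.
rewrite ler_norml; case: (leP 0 (1 - s)) => a; case: (leP 0 (1 - (s + h))) => b.
all: apply/andP; split; nra.
Qed.

Lemma continuous_max0 : continuous (fun s : R => Num.max 0 (1 - s)).
Proof.
under eq_fun do rewrite maxr_absE.
apply: contM; last exact: cont_cst.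
have c1 : continuous (fun s : R => 1 - s).
  by apply: contB; [exact: cont_cst|move=> x; exact: cvg_id].
apply: contD; first by apply: contD => //; exact: cont_cst.
apply: (@cont_comp _ _ _ (fun s : R => 0 - (1 - s)) Num.norm).
  by apply: contB => //; exact: cont_cst.
exact: norm_continuous.
Qed.

(** Compactly supported, increasing to 1 with k, and with a gradient bounded
    uniformly in k, which dominates the terms where the cutoff is
    differentiated. *)
Definition cutoff (k : nat) (x : V) : R := bump (dot x x / k.+1%:R ^+ 2).

Definition dcutoff (k : nat) (i : 'I_n) (x : V) : R :=
  - 4 * Num.max 0 (1 - dot x x / k.+1%:R ^+ 2) * (x ord0 i / k.+1%:R ^+ 2).

Lemma continuous_dot : continuous (fun x : V => dot x x).
Proof.
by apply: cont_sum => i; apply: contM; exact: continuous_rV_coord.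
Qed.

Lemma C1_cutoff k : C1 (cutoff k) (dcutoff k).
Proof.
have cq : continuous (fun x : V => dot x x / k.+1%:R ^+ 2).
  by apply: contM; [exact: continuous_dot|exact: cont_cst].
have cm : continuous (fun x : V => Num.max 0 (1 - dot x x / k.+1%:R ^+ 2)).
  exact: (cont_comp cq continuous_max0).
split; first exact: contX.
move=> i; split.
  apply: contM; first by apply: contM => //; exact: cont_cst.
  by apply: contM; [exact: continuous_rV_coord|exact: cont_cst].
move=> x; apply/is_derive_line.
pose q t : R := (dot x x + 2 * x ord0 i * t + t ^+ 2) / k.+1%:R ^+ 2.
have qE : (fun t : R => cutoff k (t *: delta_mx ord0 i + x)) = bump \o q.
  apply/funext => t; rewrite /cutoff/=; congr (bump (_ / _)).
  rewrite /dot (bigD1 i)//= [in RHS](bigD1 i)//= !mxE !eqxx/=.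
  rewrite (eq_bigr (fun j => x ord0 j * x ord0 j)); first by ring.
  by move=> j ji; rewrite !mxE (negbTE ji) mulr0 add0r.
have dq : is_derive (0 : R) (1 : R) q (2 * x ord0 i / k.+1%:R ^+ 2).
  have h1 := is_deriveZ (2 * x ord0 i) (is_derive_id (0 : R) (1 : R)).
  have h2 := is_deriveX 2 (is_derive_id (0 : R) (1 : R)).
  have h0 := is_derive_cst (dot x x) (0 : R) (1 : R).
  have := is_deriveZ (k.+1%:R ^+ 2)^-1 (is_deriveD h0 (is_deriveD h1 h2)).
  rewrite (_ : _ \*: _ = q); last first.
    apply/funext => t.
    rewrite -[LHS]/((k.+1%:R ^+ 2)^-1 * (dot x x + (2 * x ord0 i * t + t ^+ 2))) /q.
    by rewrite mulrC addrA.
  move=> h; apply: (is_derive_eq h).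
  by rewrite -![_ *: _]/(_ * _) -[id 0]/(0 : R); ring.
have q0 : q 0 = dot x x / k.+1%:R ^+ 2 by rewrite /q mulr0 expr0n !addr0.
have d1 := is_derive1_comp (is_derive_bump (q 0)) dq.
rewrite qE; apply: (is_derive_eq d1).
by rewrite q0 /dcutoff; ring.
Qed.

Lemma cutoff_itv k x : 0 <= cutoff k x <= 1.
Proof.
rewrite /cutoff /bump sqr_ge0/=.
have d0 : 0 <= dot x x / k.+1%:R ^+ 2 by rewrite divr_ge0 ?dot_ge0 ?sqr_ge0.
rewrite expr_le1// ?le_max ?lexx// ge_max ler01/= gerBl; exact: d0.
Qed.

Lemma coord_sqr_le_dot (x : V) i : x ord0 i ^+ 2 <= dot x x.
Proof.
rewrite /dot (bigD1 i)//= -expr2 lerDl; apply: sumr_ge0 => j _.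
by rewrite -expr2 sqr_ge0.
Qed.

Lemma csupp_cutoff k : compactly_supported (cutoff k).
Proof.
split; first by have [] := C1_cutoff k.
exists k.+1%:R => x kx; rewrite /cutoff /bump.
have K0 : 0 < k.+1%:R ^+ 2 :> R by rewrite exprn_gt0// ltr0n.
suff -> : Num.max 0 (1 - dot x x / k.+1%:R ^+ 2) = 0 by rewrite expr0n.
apply/max_idPl; rewrite subr_le0 ler_pdivlMr// mul1r.
have [x0|x0] := eqVneq `|x| 0.
  by move: kx; rewrite x0 ltNge ler0n.
have [|[i j] xi] := @mx_norm_neq0 _ _ _ x.
  exact: x0.
have {}xi : `|x| = `|x ord0 j|.
  by move: xi; rewrite /= (ord1 i) => <-.
apply: le_trans (coord_sqr_le_dot x j).
rewrite -[leRHS]real_normK ?num_real// -xi.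
by rewrite lerXn2r ?nnegrE// ltW.
Qed.

Lemma dcutoff_bound k i x : `|dcutoff k i x| <= 4.
Proof.
rewrite /dcutoff; set K : R := k.+1%:R.
have K1 : 1 <= K by rewrite ler1n.
have K0 : 0 < K by exact: lt_le_trans K1.
have K20 : 0 < K ^+ 2 by rewrite exprn_gt0.
have d0 : 0 <= dot x x / K ^+ 2 by rewrite divr_ge0 ?dot_ge0 ?sqr_ge0.
have [s|s] := leP 0 (1 - dot x x / K ^+ 2); last by rewrite mulr0 mul0r normr0.
rewrite -mulrA mulNr normrN normrM [`|4|]ger0_norm// ler_piMr// normrM.
rewrite (ger0_norm s) mulr_ile1//; first by rewrite gerBl.
have iK : 0 <= (K ^+ 2)^-1 by rewrite invr_ge0 ltW.
rewrite normrM (ger0_norm iK) ler_pdivrMr// mul1r.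
have xd := coord_sqr_le_dot x i.
have dK : dot x x <= K ^+ 2.
  by move: s; rewrite subr_ge0 ler_pdivrMr// mul1r.
have xK : `|x ord0 i| <= K.
  rewrite -(ler_pXn2r (n := 2))// ?nnegrE ?(ltW K0)//.
  by rewrite real_normK ?num_real//; exact: le_trans dK.
by apply: le_trans xK _; rewrite expr2 ler_peMl// ltW.
Qed.

Lemma cvg_invr_sqr : (k.+1%:R ^+ 2)^-1 @[k --> \oo] --> (0 : R).
Proof.
rewrite (_ : (fun k => _) = (fun k : nat => k.+1%:R^-1 * k.+1%:R^-1)); last first.
  by apply/funext => k; rewrite -exprVn expr2.
by rewrite -[X in _ --> X](mulr0 (0 : R)); apply: cvgM; exact: cvg_harmonic.
Qed.

Lemma cvg_dot_scaled (x : V) : dot x x / k.+1%:R ^+ 2 @[k --> \oo] --> (0 : R).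
Proof.
rewrite -[X in _ --> X](mulr0 (dot x x)); by apply: cvgM;
  [exact: cvg_cst|exact: cvg_invr_sqr].
Qed.

Lemma cvg_max0_scaled (x : V) :
  Num.max 0 (1 - dot x x / k.+1%:R ^+ 2) @[k --> \oo] --> (1 : R).
Proof.
have := cvg_comp _ _ (cvg_dot_scaled x) (@continuous_max0 0).
by rewrite /= subr0 max_r.
Qed.

Lemma cvg_cutoff (x : V) : cutoff k x @[k --> \oo] --> (1 : R).
Proof.
rewrite -[X in _ --> X](mulr1 1) /cutoff /bump.
by under eq_fun do rewrite expr2; apply: cvgM; exact: cvg_max0_scaled.
Qed.

Lemma cvg_dcutoff i (x : V) : dcutoff k i x @[k --> \oo] --> (0 : R).
Proof.
rewrite -[X in _ --> X](mulr0 (- 4 * 1)) /dcutoff; apply: cvgM.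
  by apply: cvgM; [exact: cvg_cst|exact: cvg_max0_scaled].
rewrite -[X in _ --> X](mulr0 (x ord0 i)); by apply: cvgM;
  [exact: cvg_cst|exact: cvg_invr_sqr].
Qed.

End cutoff.

(** * Gaussian divergence of a square-integrable vector field *)

Section global.
Variables (R : realType) (n : nat).
Local Notation V := 'rV[R]_n.
Local Notation E f := (\int[gauss R n]_x f x)%R.
Local Notation rho := (@gauss_pdf R n).

Definition gaussL1 (f : V -> R) := (gauss R n).-integrable setT (EFin \o f).

Lemma gaussL1D (f g : V -> R) : gaussL1 f -> gaussL1 g ->
  gaussL1 (fun x => f x + g x).
Proof. by move=> jf jg; exact: (integrableD measurableT jf jg). Qed.

Lemma gaussL1B (f g : V -> R) : gaussL1 f -> gaussL1 g ->
  gaussL1 (fun x => f x - g x).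
Proof. by move=> jf jg; exact: (integrableB measurableT jf jg). Qed.

Lemma gaussL1Z k (f : V -> R) : gaussL1 f -> gaussL1 (fun x => k * f x).
Proof. by move=> jf; exact: (integrableZl measurableT k jf). Qed.

Lemma gaussL1_cst k : gaussL1 (fun _ => k).
Proof.
apply/integrableP; split; first exact: measurable_cst.
by rewrite integral_cst//= [X in (_ * X)%E]probability_setT mule1 ltry.
Qed.

Lemma gaussL1_sum m (f : 'I_m -> V -> R) : (forall i, gaussL1 (f i)) ->
  gaussL1 (fun x => \sum_(i < m) f i x).
Proof.
elim: m f => [|m IH] f jf.
  by under eq_fun do rewrite big_ord0; exact: gaussL1_cst.
under eq_fun do rewrite big_ord_recl.
by apply: gaussL1D; [exact: jf|apply: IH => i; exact: jf].
Qed.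

Lemma gaussL1_le (f g : V -> R) : measurable_fun setT f -> gaussL1 g ->
  (forall x, `|f x| <= g x) -> gaussL1 f.
Proof.
move=> mf jg fg; apply: (le_integrable measurableT _ _ jg).
  exact/measurable_EFinP.
move=> x _; rewrite lee_fin /=.
by apply: le_trans (fg x) _; exact: ler_norm.
Qed.

Lemma gaussL1M (f g : V -> R) : measurable_fun setT f -> measurable_fun setT g ->
  gaussL1 (fun x => f x ^+ 2) -> gaussL1 (fun x => g x ^+ 2) ->
    gaussL1 (fun x => f x * g x).
Proof.
move=> mf mg jf jg; apply: (gaussL1_le _ (gaussL1D jf jg));
  first exact: measurable_funM.
move=> x; rewrite ler_norml; apply/andP; split.
  by rewrite -subr_ge0; nra.
by rewrite -subr_ge0; nra.
Qed.

Lemma gauss_meanD (f g : V -> R) : gaussL1 f -> gaussL1 g ->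
  E (fun x => f x + g x) = E f + E g.
Proof. by move=> jf jg; exact: RintegralD. Qed.

Lemma gauss_meanB (f g : V -> R) : gaussL1 f -> gaussL1 g ->
  E (fun x => f x - g x) = E f - E g.
Proof. by move=> jf jg; exact: RintegralB. Qed.

Lemma gauss_meanZ k (f : V -> R) : gaussL1 f -> E (fun x => k * f x) = k * E f.
Proof. by move=> jf; exact: RintegralZl. Qed.

Lemma gauss_mean_cst k : E (fun _ => k) = k.
Proof. by rewrite Rintegral_cst// [X in fine X]probability_setT mulr1. Qed.

Lemma gauss_mean_sum m (f : 'I_m -> V -> R) : (forall i, gaussL1 (f i)) ->
  E (fun x => \sum_(i < m) f i x) = \sum_(i < m) E (f i).
Proof.
elim: m f => [|m IH] f jf.
  under eq_Rintegral do rewrite big_ord0.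
  by rewrite big_ord0 gauss_mean_cst.
under eq_Rintegral do rewrite big_ord_recl.
rewrite big_ord_recl -IH//; apply: gauss_meanD; first exact: jf.
exact: gaussL1_sum.
Qed.

Lemma gauss_mean_eq (f g : V -> R) : (forall x, f x = g x) -> E f = E g.
Proof. by move=> fg; apply: eq_Rintegral => x _; exact: fg. Qed.

Lemma gauss_mean_le (f g : V -> R) : gaussL1 f -> gaussL1 g ->
  (forall x, f x <= g x) ->
  E f <= E g.
Proof. by move=> jf jg fg; apply: le_Rintegral. Qed.

Lemma gauss_mean_EFin (f : V -> R) : gaussL1 f ->
  (\int[gauss R n]_x (f x)%:E)%E = (E f)%:E.
Proof. by move=> jf; rewrite fineK//; exact: integrable_fin_num. Qed.

Lemma gauss_mean_limit0 (Phi : nat -> V -> R) (Phioo g : V -> R) :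
  (forall k, measurable_fun setT (Phi k)) -> measurable_fun setT Phioo ->
  (forall x, Phi k x @[k --> \oo] --> Phioo x) -> gaussL1 g ->
  (forall k x, `|Phi k x| <= g x) -> (forall k, E (Phi k) = 0) ->
  E Phioo = 0.
Proof.
move=> mP mPoo cP jg Pg P0.
have cPE x : (Phi k x)%:E @[k --> \oo] --> (Phioo x)%:E.
  by apply: cvg_EFin; [exact: nearW|exact: cP].
have [iP _ cI] := @dominated_convergence _ V R (gauss R n) setT measurableT
  (fun k x => (Phi k x)%:E) (fun x => (Phioo x)%:E) (EFin \o g)
  (fun k => (measurable_EFinP _ _).2 (mP k)) ((measurable_EFinP _ _).2 mPoo)
  (aeW _ (fun x _ => cPE x)) jg (aeW _ (fun x k _ => Pg k x)).
have jP k : gaussL1 (Phi k) by exact: gaussL1_le (mP k) jg (Pg k).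
move: cI; rewrite (_ : (fun k => _) = fun=> 0%:E); last first.
  by apply/funext => k; rewrite gauss_mean_EFin// P0.
by move=> /cvg_lim h; rewrite /Rintegral -h// lim_cst.
Qed.

Section field.
Variables (u : 'I_n -> V -> R) (H : 'I_n -> 'I_n -> V -> R).
Hypothesis Cu : forall j, C1 (u j) (fun i => H i j).
Hypothesis ju : forall j, gaussL1 (fun x => u j x ^+ 2).
Hypothesis jW : gaussL1 (fun x => gauss_div u H x ^+ 2).

Let cu j : continuous (u j). Proof. by have [] := Cu j. Qed.
Let cH i j : continuous (H i j). Proof. by have [_ /(_ i)[]] := Cu j. Qed.
Let cW : continuous (gauss_div u H). Proof. exact: continuous_gauss_div. Qed.
Let cc k : continuous (@cutoff R n k). Proof. by have [] := @C1_cutoff R n k. Qed.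
Let cdc k i : continuous (@dcutoff R n k i).
Proof. by have [_ /(_ i)[]] := @C1_cutoff R n k. Qed.

Let mul4_le (a t b : R) : `|t| <= 4 -> `|a * (t * b)| <= 2 * (a ^+ 2 + b ^+ 2).
Proof.
move=> t4; rewrite !normrM -(real_normK (num_real a)) -(real_normK (num_real b)).
have a0 := normr_ge0 a; have b0 := normr_ge0 b; have t0 := normr_ge0 t.
apply: (@le_trans _ _ (`|a| * (4 * `|b|))).
  by apply: ler_wpM2l => //; exact: ler_wpM2r.
rewrite -subr_ge0 (_ : _ - _ = 2 * (`|a| - `|b|) ^+ 2); last by ring.
by rewrite mulr_ge0 ?sqr_ge0.
Qed.

Let mul1_le (a t b : R) : 0 <= t <= 1 -> `|a * (t * b)| <= a ^+ 2 + b ^+ 2.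
Proof.
move=> /andP[t0 t1].
rewrite !normrM -(real_normK (num_real a)) -(real_normK (num_real b)) (ger0_norm t0).
have a0 := normr_ge0 a; have b0 := normr_ge0 b.
apply: (@le_trans _ _ (`|a| * `|b|)).
  by apply: ler_wpM2l => //; exact: ler_piMl.
by rewrite -subr_ge0; nra.
Qed.

(** The cutoff version, applied to cutoff k * z, is [Leb_gauss_ibp]. Its terms
    are products of two square-integrable functions with a factor bounded by 1
    or by 4, and those that contain a derivative of the cutoff tend to 0. *)
Lemma gauss_ibp (z : V -> R) (dz : 'I_n -> V -> R) : C1 z dz ->
  gaussL1 (fun x => z x ^+ 2) -> (forall i, gaussL1 (fun x => dz i x ^+ 2)) ->
  E (fun x => z x * gauss_div u H x + \sum_(i < n) dz i x * u i x) = 0.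
Proof.
move=> Cz jz jdz; have cz : continuous z by have [] := Cz.
have cdz i : continuous (dz i) by have [_ /(_ i)[]] := Cz.
pose Phi k x := z x * (cutoff k x * gauss_div u H x) +
  \sum_(i < n) (z x * (dcutoff k i x * u i x) + dz i x * (cutoff k x * u i x)).
have cPhi k : continuous (Phi k).
  apply: contD; first by do 2 apply: contM => //.
  by apply: cont_sum => i; apply: contD; do 2 apply: contM => //.
pose g x := z x ^+ 2 + gauss_div u H x ^+ 2 +
  \sum_(i < n) (2 * (z x ^+ 2 + u i x ^+ 2) + (dz i x ^+ 2 + u i x ^+ 2)).
apply: (@gauss_mean_limit0 Phi _ g).
- by move=> k; exact: continuous_measurable_rV.
- apply: continuous_measurable_rV; apply: contD; first exact: contM.
  by apply: cont_sum => i; exact: contM.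
- move=> x; rewrite (_ : _ + _ = z x * (1 * gauss_div u H x) +
    \sum_(i < n) (z x * (0 * u i x) + dz i x * (1 * u i x))); last first.
    rewrite mul1r; congr (_ + _); apply: eq_bigr => i _.
    by rewrite mul0r mulr0 add0r mul1r.
  apply: cvgD; first by do 2 (apply: cvgM; [by [exact: cvg_cst|exact: cvg_cutoff]|]); exact: cvg_cst.
  apply: cvg_sum_ord => i; apply: cvgD.
    by apply: cvgM; [exact: cvg_cst|apply: cvgM; [exact: cvg_dcutoff|exact: cvg_cst]].
  by apply: cvgM; [exact: cvg_cst|apply: cvgM; [exact: cvg_cutoff|exact: cvg_cst]].
- apply: gaussL1D; first exact: gaussL1D.
  by apply: gaussL1_sum => i; apply: gaussL1D; [apply: gaussL1Z|]; exact: gaussL1D.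
- move=> k x; apply: le_trans (ler_normD _ _) _; apply: lerD.
    by apply: mul1_le; exact: cutoff_itv.
  apply: le_trans (ler_norm_sum _ _ _) _; apply: ler_sum => i _.
  apply: le_trans (ler_normD _ _) _; apply: lerD.
    by apply: mul4_le; exact: dcutoff_bound.
  by apply: mul1_le; exact: cutoff_itv.
move=> k; rewrite Rintegral_gauss; last exact: continuous_measurable_rV.
have sc := @csupp_cutoff R n k; have Cc := @C1_cutoff R n k.
have Cg := C1_mul Cc Cz; have sg := csuppM sc cz.
have cr := @continuous_gauss_pdf R n.
have cx i := @continuous_rV_coord R n i.
have sA i : compactly_supported (fun x : V =>
    rho x * (cutoff k x * z x * (H i i x - x ord0 i * u i x))).
  by apply: csuppMl => //; apply: csuppM => //; apply: contB => //; exact: contM.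
have sB i : compactly_supported (fun x : V =>
    rho x * ((dcutoff k i x * z x + cutoff k x * dz i x) * u i x)).
  apply: csuppMl => //; apply: csuppM => //; apply: csuppD; apply: csuppM => //.
  exact: csupp_derive sc Cc.
transitivity (\sum_(i < n) (\int[lebesgue_rV R n]_x
    (rho x * (cutoff k x * z x * (H i i x - x ord0 i * u i x))) +
  \int[lebesgue_rV R n]_x
    (rho x * ((dcutoff k i x * z x + cutoff k x * dz i x) * u i x)))%R).
  under [RHS]eq_bigr do rewrite -LebD//.
  rewrite -Leb_sum; last by move=> i; exact: csuppD.
  apply: eq_Rintegral => x _; rewrite /Phi /gauss_div mulrDl !mulr_sumr !mulr_suml.
  by rewrite -big_split; apply: eq_bigr => i _; rewrite /=; ring.
apply: big1 => i _.
by rewrite (Leb_gauss_ibp i sg Cg (Cu i)) addNr.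
Qed.

Hypothesis jH : forall i j, gaussL1 (fun x => H i j x ^+ 2).

(** Sum over i of [gauss_div_ibp] with the cutoffs for c; they are removed as in
    [gauss_ibp]. *)
Lemma gauss_div_sqr :
  E (fun x => gauss_div u H x ^+ 2) =
  E (fun x => \sum_(i < n) \sum_(j < n) H i j x * H j i x) +
  E (fun x => \sum_(i < n) u i x ^+ 2).
Proof.
pose W := gauss_div u H.
pose Phi k x := W x * (cutoff k x * W x) + \sum_(i < n)
  (W x * (dcutoff k i x * u i x) -
   (\sum_(j < n) (H i j x * (dcutoff k j x * u i x) + H i j x * (cutoff k x * H j i x))
    + u i x * (cutoff k x * u i x))).
have cPhi k : continuous (Phi k).
  apply: contD; first by do 2 apply: contM => //.
  apply: cont_sum => i; apply: contB; first by do 2 apply: contM => //.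
  apply: contD; last by do 2 apply: contM => //.
  by apply: cont_sum => j; apply: contD; do 2 apply: contM => //.
pose Phioo x := W x ^+ 2 - (\sum_(i < n) \sum_(j < n) H i j x * H j i x +
  \sum_(i < n) u i x ^+ 2).
have mH i j : measurable_fun setT (H i j) by exact: continuous_measurable_rV.
have jHH : gaussL1 (fun x => \sum_(i < n) \sum_(j < n) H i j x * H j i x).
  by apply: gaussL1_sum => i; apply: gaussL1_sum => j; exact: gaussL1M.
have juu : gaussL1 (fun x => \sum_(i < n) u i x ^+ 2) by exact: gaussL1_sum.
pose g x := W x ^+ 2 + W x ^+ 2 + \sum_(i < n) (2 * (W x ^+ 2 + u i x ^+ 2) +
  (\sum_(j < n) (2 * (H i j x ^+ 2 + u i x ^+ 2) + (H i j x ^+ 2 + H j i x ^+ 2)) +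
   (u i x ^+ 2 + u i x ^+ 2))).
suff : E Phioo = 0.
  rewrite /Phioo gauss_meanB//; last exact: gaussL1D.
  by rewrite gauss_meanD// => /eqP; rewrite subr_eq0 => /eqP.
apply: (@gauss_mean_limit0 Phi _ g).
- by move=> k; exact: continuous_measurable_rV.
- apply: continuous_measurable_rV; apply: contB; first exact: contX.
  apply: contD; last by apply: cont_sum => i; exact: contX.
  by apply: cont_sum => i; apply: cont_sum => j; exact: contM.
- move=> x; rewrite (_ : Phioo x = W x * (1 * W x) + \sum_(i < n)
  (W x * (0 * u i x) -
   (\sum_(j < n) (H i j x * (0 * u i x) + H i j x * (1 * H j i x))
    + u i x * (1 * u i x)))); last first.
    rewrite /Phioo mul1r -expr2 -big_split/= -sumrN; congr (_ + _).
    apply: eq_bigr => i _; rewrite mul0r mulr0 sub0r mul1r -expr2; congr (- (_ + _)).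
    by apply: eq_bigr => j _; rewrite mul1r mulr0 add0r.
  apply: cvgD.
    by apply: cvgM; [exact: cvg_cst|apply: cvgM; [exact: cvg_cutoff|exact: cvg_cst]].
  apply: cvg_sum_ord => i; apply: cvgB.
    by apply: cvgM; [exact: cvg_cst|apply: cvgM; [exact: cvg_dcutoff|exact: cvg_cst]].
  apply: cvgD.
    apply: cvg_sum_ord => j; apply: cvgD.
      by apply: cvgM; [exact: cvg_cst|apply: cvgM; [exact: cvg_dcutoff|exact: cvg_cst]].
    by apply: cvgM; [exact: cvg_cst|apply: cvgM; [exact: cvg_cutoff|exact: cvg_cst]].
  by apply: cvgM; [exact: cvg_cst|apply: cvgM; [exact: cvg_cutoff|exact: cvg_cst]].
- apply: gaussL1D; first exact: gaussL1D.
  apply: gaussL1_sum => i; apply: gaussL1D; first by apply: gaussL1Z; exact: gaussL1D.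
  apply: gaussL1D; last exact: gaussL1D.
  apply: gaussL1_sum => j; apply: gaussL1D; last exact: gaussL1D.
  by apply: gaussL1Z; exact: gaussL1D.
- move=> k x; apply: le_trans (ler_normD _ _) _; apply: lerD.
    by apply: mul1_le; exact: cutoff_itv.
  apply: le_trans (ler_norm_sum _ _ _) _; apply: ler_sum => i _.
  apply: le_trans (ler_normB _ _) _; apply: lerD.
    by apply: mul4_le; exact: dcutoff_bound.
  apply: le_trans (ler_normD _ _) _; apply: lerD.
    apply: le_trans (ler_norm_sum _ _ _) _; apply: ler_sum => j _.
    apply: le_trans (ler_normD _ _) _; apply: lerD.
      by apply: mul4_le; exact: dcutoff_bound.
    by apply: mul1_le; exact: cutoff_itv.
  by apply: mul1_le; exact: cutoff_itv.
move=> k; rewrite Rintegral_gauss; last exact: continuous_measurable_rV.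
have sc := @csupp_cutoff R n k; have Cc := @C1_cutoff R n k.
have sdc i := csupp_derive i sc Cc.
have cr := @continuous_gauss_pdf R n.
have cx i := @continuous_rV_coord R n i.
pose A i (x : V) := W x * (rho x * (dcutoff k i x * u i x +
  cutoff k x * (H i i x - x ord0 i * u i x))).
pose B i (x : V) := rho x * (\sum_(j < n) H i j x *
  (dcutoff k j x * u i x + cutoff k x * H j i x)).
pose D i (x : V) := rho x * (cutoff k x * u i x ^+ 2).
have sA i : compactly_supported (A i).
  apply: csuppMl => //; apply: csuppMl => //; apply: csuppD; apply: csuppM => //.
  by apply: contB => //; exact: contM.
have sB i : compactly_supported (B i).
  apply: csuppMl => //; apply: csupp_sum => j; apply: csuppMl => //.
  by apply: csuppD; apply: csuppM.
have sD i : compactly_supported (D i).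
  by apply: csuppMl => //; apply: csuppM => //; exact: contX.
have sBD i : compactly_supported (fun x => -1 * (B i x + D i x)).
  by apply: csuppMl; [exact: cont_cst|exact: csuppD].
transitivity (\sum_(i < n) (\int[lebesgue_rV R n]_x A i x +
  \int[lebesgue_rV R n]_x (-1 * (B i x + D i x))))%R.
  under [RHS]eq_bigr do rewrite -LebD//.
  rewrite -Leb_sum; last by move=> i; exact: csuppD.
  apply: eq_Rintegral => x _.
  have E1 : W x * (cutoff k x * W x) * rho x = \sum_(i < n)
      W x * (cutoff k x * (H i i x - x ord0 i * u i x)) * rho x.
    by rewrite {2}/W /gauss_div !mulr_sumr mulr_suml.
  rewrite /Phi mulrDl E1 mulr_suml -big_split; apply: eq_bigr => i _.
  rewrite /A /B /D /=.
  rewrite (eq_bigr (fun j => H i j x *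
    (dcutoff k j x * u i x + cutoff k x * H j i x))); first by ring.
  by move=> j _; ring.
apply: big1 => i _; rewrite LebZ; last exact: csuppD.
rewrite LebD// (gauss_div_ibp Cu sc Cc i) mulN1r; apply/eqP; rewrite subr_eq0;
  apply/eqP.
by [].
Qed.

End field.
End global.

(** * Even functions *)

Section even_functions.
Variables (R : realType) (n : nat).
Local Notation V := 'rV[R]_n.
Local Notation E f := (\int[gauss R n]_x f x)%R.

Lemma term_le_sum (m : nat) (F : 'I_m -> R) (i : 'I_m) :
  (forall j, 0 <= F j) -> F i <= \sum_(j < m) F j.
Proof. by move=> F0; rewrite (bigD1 i)//= lerDl; apply: sumr_ge0. Qed.

(** The difference of the two sides is half of |a - a^T|^2. Applied to the
    Hessian, for the trace in Bochner's formula. *)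
Lemma sum_mul_transpose_le (m : nat) (a : 'I_m -> 'I_m -> R) :
  \sum_(i < m) \sum_(j < m) a i j * a j i <= \sum_(i < m) \sum_(j < m) a i j ^+ 2.
Proof.
have -> : \sum_(i < m) \sum_(j < m) a i j ^+ 2 =
  \sum_(i < m) \sum_(j < m) 2^-1 * (a i j ^+ 2 + a j i ^+ 2).
  under [RHS]eq_bigr do rewrite -mulr_sumr big_split.
  rewrite -mulr_sumr big_split/= [X in _ = _ * (_ + X)]exchange_big/=.
  by field.
apply: ler_sum => i _; apply: ler_sum => j _.
rewrite -subr_ge0 (_ : _ - _ = 2^-1 * (a i j - a j i) ^+ 2); last by field.
by rewrite mulr_ge0 ?sqr_ge0// invr_ge0.
Qed.

Lemma Ck1_C1 (f : V -> R) : Ck 1 f -> C1 f (fun i => partial i f).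
Proof.
move=> [df cf]; split=> [x|i]; first exact: differentiable_continuous.
split=> [|x]; first exact: cf.
by apply: derivableP; apply: diff_derivable.
Qed.

Lemma C1_subcst (f : V -> R) df (m : R) : C1 f df -> C1 (fun x => f x - m) df.
Proof.
move=> [cf Hf]; split=> [|i]; first by apply: contB => //; exact: cont_cst.
have [cd dd] := Hf i; split=> // x.
by apply: (is_derive_eq (is_deriveB (dd x) (is_derive_cst m x _))); rewrite subr0.
Qed.

Lemma C1_even_odd (f : V -> R) df : C1 f df -> (forall x, f (- x) = f x) ->
  forall i x, df i (- x) = - df i x.
Proof.
move=> Cf fe i x; have [_ /(_ i)[_ /(_ x)[_ <-]]] := Cf.
have [_ /(_ i)[_ /(_ x)[_ H]]] := C1_affine (-1) 0 Cf.
move: H; rewrite (_ : (fun z => f (-1 *: z + 0)) = f); last first.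
  by apply/funext => z; rewrite addr0 scaleN1r.
by rewrite addr0 scaleN1r mulN1r => ->; rewrite opprK.
Qed.

(** Expresses the variance without the mean, in a form invariant under
    rotations of the pair (x, y). *)
Lemma gauss_var_copies (f : V -> R) : measurable_fun setT f ->
  gaussL1 f -> gaussL1 (fun x => f x ^+ 2) ->
  (\int[gauss R n]_x \int[gauss R n]_y ((f x - f y) ^+ 2)%:E =
   (2 * gauss_var f)%:E)%E.
Proof.
move=> mf jf jf2; set m := E f; set M := E (fun x => f x ^+ 2).
have inner x : (\int[gauss R n]_y ((f x - f y) ^+ 2)%:E =
    (f x ^+ 2 + M - 2 * m * f x)%:E)%E.
  have jx : gaussL1 (fun y => f x ^+ 2 + f y ^+ 2)
    by exact: gaussL1D (gaussL1_cst _ _) jf2.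
  have jy := gaussL1Z (2 * f x) jf.
  rewrite (_ : (fun y => _) = (fun y => (f x ^+ 2 + f y ^+ 2 - 2 * f x * f y)%:E));
    last first.
    by apply/funext => y; congr EFin; ring.
  rewrite gauss_mean_EFin; last exact: gaussL1B.
  rewrite gauss_meanB// gauss_meanD//; last exact: gaussL1_cst.
  by rewrite gauss_mean_cst gauss_meanZ// -/m -/M; congr EFin; ring.
under eq_integral do rewrite inner.
have j1 : gaussL1 (fun x => f x ^+ 2 + M) by exact: gaussL1D jf2 (gaussL1_cst _ _).
have j2 := gaussL1Z (2 * m) jf.
rewrite gauss_mean_EFin; last exact: gaussL1B.
rewrite gauss_meanB// gauss_meanD//; last exact: gaussL1_cst.
by rewrite gauss_mean_cst gauss_meanZ// -/m -/M /gauss_var -/m -/M; congr EFin; ring.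
Qed.

Lemma gauss_var_le_half_grad (f : V -> R) df : C1 f df ->
  (forall x, f (- x) = f x) -> gaussL1 f -> gaussL1 (fun x => f x ^+ 2) ->
  gaussL1 (fun x => \sum_(i < n) df i x ^+ 2) ->
  gauss_var f <= 2^-1 * E (fun x => \sum_(i < n) df i x ^+ 2).
Proof.
move=> Cf fe jf jf2 jdf; have [mf _] := measurable_C1 Cf.
have := poincare_even Cf fe; rewrite gauss_var_copies// gauss_mean_EFin// lee_fin.
by lra.
Qed.

Lemma gauss_var_center (f : V -> R) : gaussL1 f -> gaussL1 (fun x => f x ^+ 2) ->
  E (fun x => (f x - E f) ^+ 2) = gauss_var f.
Proof.
move=> jf jf2; set m := E f.
have j1 : gaussL1 (fun x => f x ^+ 2 + m ^+ 2)
  by exact: gaussL1D jf2 (gaussL1_cst _ _).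
rewrite (gauss_mean_eq (g := fun x => f x ^+ 2 + m ^+ 2 - 2 * m * f x)); last first.
  by move=> x; ring.
rewrite gauss_meanB//; last exact: gaussL1Z.
rewrite gauss_meanD//; last exact: gaussL1_cst.
by rewrite gauss_mean_cst gauss_meanZ// -/m /gauss_var -/m; ring.
Qed.

(** The four relations of which the theorem is a linear consequence. The second
    is the Poincare inequality for the odd functions u_i, and the expression in
    the third is the integral of (W + 2 (f - m))^2, where m is the mean of f. *)
Lemma even_gauss_inequalities (f : V -> R) (u : 'I_n -> V -> R)
    (H : 'I_n -> 'I_n -> V -> R) :
  C1 f u -> (forall j, C1 (u j) (fun i => H i j)) ->
  (forall x, f (- x) = f x) ->
  gaussL1 (fun x => f x ^+ 2) ->
  gaussL1 (fun x => \sum_(i < n) u i x ^+ 2) ->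
  gaussL1 (fun x => \sum_(i < n) \sum_(j < n) H i j x ^+ 2) ->
  gaussL1 (fun x => gauss_div u H x ^+ 2) ->
  let A := E (fun x => gauss_div u H x ^+ 2) in
  let G := E (fun x => \sum_(i < n) u i x ^+ 2) in
  let HS := E (fun x => \sum_(i < n) \sum_(j < n) H i j x ^+ 2) in
  [/\ A <= HS + G, G <= HS, 0 <= A - 4 * G + 4 * gauss_var f &
      gauss_var f <= 2^-1 * G].
Proof.
move=> Cf Cu feven jf2 jG jHS jW; set W := gauss_div u H => A G HS.
have [mf mu] := measurable_C1 Cf.
have mH i j : measurable_fun setT (H i j) by have [_ /(_ i)] := measurable_C1 (Cu j).
have jf : gaussL1 f.
  apply: (gaussL1_le mf (gaussL1D (gaussL1_cst _ 1) jf2)) => x.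
  rewrite -(real_normK (num_real (f x))); have := normr_ge0 (f x); nra.
have ju i : gaussL1 (fun x => u i x ^+ 2).
  apply: (gaussL1_le _ jG); first exact: measurable_funX.
  move=> x; rewrite ger0_norm ?sqr_ge0//.
  by apply: (@term_le_sum _ (fun i => u i x ^+ 2)) => j; exact: sqr_ge0.
have jH i j : gaussL1 (fun x => H i j x ^+ 2).
  apply: (gaussL1_le _ jHS); first exact: measurable_funX.
  move=> x; rewrite ger0_norm ?sqr_ge0//.
  apply: le_trans (@term_le_sum _ (fun j => H i j x ^+ 2) j _) _.
    by move=> l; exact: sqr_ge0.
  apply: (@term_le_sum _ (fun i => \sum_(j < n) H i j x ^+ 2) i) => l.
  exact: sum_sqr_ge0.
have AHG : A <= HS + G.
  rewrite /A (gauss_div_sqr Cu ju jW jH) lerD2r; apply: gauss_mean_le => // [|x].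
    by apply: gaussL1_sum => i; apply: gaussL1_sum => j; exact: gaussL1M.
  exact: (sum_mul_transpose_le (fun i j => H i j x)).
have GHS : G <= HS.
  rewrite /G /HS (gauss_mean_eq (f := fun x => \sum_(i < n) \sum_(j < n) H i j x ^+ 2)
    (fun x => exchange_big _ _ _ _ _ _)).
  rewrite !gauss_mean_sum//; last by move=> i; exact: gaussL1_sum.
  apply: ler_sum => i _.
  have := poincare_odd (Cu i) (C1_even_odd Cf feven i).
  by rewrite !gauss_mean_EFin ?lee_fin//; exact: gaussL1_sum.
have varG : gauss_var f <= 2^-1 * G by exact: gauss_var_le_half_grad.
have lower : 0 <= A - 4 * G + 4 * gauss_var f.
  (* of all combinations W + t (f - m), t = 2 gives the coefficients 1 and - 4
     of the lower bound *)
  pose m := \int[gauss R n]_x f x.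
  pose z x := f x - m.
  have Cz : C1 z u by exact: C1_subcst.
  have mz : measurable_fun setT z by have [] := measurable_C1 Cz.
  have mW : measurable_fun setT W.
    by apply: continuous_measurable_rV; exact: continuous_gauss_div.
  have jz : gaussL1 z by exact: gaussL1B jf (gaussL1_cst _ _).
  have jz2 : gaussL1 (fun x => z x ^+ 2).
    rewrite (_ : (fun x => _) = (fun x => f x ^+ 2 + m ^+ 2 - 2 * m * f x)).
      by apply: gaussL1B; [exact: gaussL1D jf2 (gaussL1_cst _ _)|exact: gaussL1Z].
    by apply/funext => x; rewrite /z; ring.
  have jzW : gaussL1 (fun x => z x * W x) by exact: gaussL1M.
  have ibp : \int[gauss R n]_x (z x * W x) = - G.
    apply/eqP; rewrite -addr_eq0 -gauss_meanD//.
    by rewrite -[X in _ == X](gauss_ibp Cu ju jW Cz jz2 ju).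
  rewrite -(gauss_var_center jf jf2) -/m.
  have <- : \int[gauss R n]_x ((W x + 2 * z x) ^+ 2) =
      A - 4 * G + 4 * \int[gauss R n]_x ((f x - m) ^+ 2).
    rewrite (gauss_mean_eq (g := fun x => W x ^+ 2 + 4 * (z x * W x) + 4 * z x ^+ 2)); last first.
      by move=> x; ring.
    have j4 := gaussL1Z 4 jzW; have j5 := gaussL1Z 4 jz2.
    by rewrite gauss_meanD//;
      [rewrite gauss_meanD// !gauss_meanZ// ibp mulrN|exact: gaussL1D].
  by apply: Rintegral_ge0 => x _; exact: sqr_ge0.
by split.
Qed.

End even_functions.

Theorem corollary20 (R : realType) (n : nat) (eta : 'rV[R]_n -> R)
  (eta_C2 : Ck 2 eta)
  (eta_L2 : eta \in Lfun (gauss R n) 2%:E)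
  (eta_even : forall x, eta (- x) = eta x)
  (grad_L2 : (fun x => enorm (grad eta x)) \in Lfun (gauss R n) 2%:E)
  (hess_L2 : (fun x => hs_norm (hess eta x)) \in Lfun (gauss R n) 2%:E)
  (OU_L2 : (fun x => laplacian eta x - dot (grad eta x) x)
             \in Lfun (gauss R n) 2%:E) :
  2^-1 * \int[gauss R n]_x (laplacian eta x - dot (grad eta x) x) ^+ 2
    <= \int[gauss R n]_x hs_norm (hess eta x) ^+ 2
  /\
  (\int[gauss R n]_x enorm (grad eta x) ^+ 2
     - 4^-1 * \int[gauss R n]_x (laplacian eta x - dot (grad eta x) x) ^+ 2
     <= gauss_var eta
   /\
   gauss_var eta
     <= \int[gauss R n]_x enorm (grad eta x) ^+ 2
        - 2^-1 * \int[gauss R n]_x (laplacian eta x - dot (grad eta x) x) ^+ 2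
        + 2^-1 * \int[gauss R n]_x hs_norm (hess eta x) ^+ 2).
Proof.
pose u i := partial i eta.
pose H i j := partial i (partial j eta).
have [dEta C1part] := eta_C2.
have Cu j : C1 (u j) (fun i => H i j) by exact: Ck1_C1 (C1part j).
have Ceta : C1 eta u.
  by apply: Ck1_C1; split => // i; have [] := Cu i.
have WE x : laplacian eta x - dot (grad eta x) x = gauss_div u H x.
  rewrite /laplacian /dot /mxtrace -sumrB; apply: eq_bigr => j _.
  by rewrite !mxE mulrC.
have GE x : enorm (grad eta x) ^+ 2 = \sum_(i < n) u i x ^+ 2.
  rewrite /enorm sqr_sqrtr ?dot_ge0//; apply: eq_bigr => i _.
  by rewrite mxE expr2.
have HE x : hs_norm (hess eta x) ^+ 2 = \sum_(i < n) \sum_(j < n) H i j x ^+ 2.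
  rewrite /hs_norm sqr_sqrtr; last first.
    by apply: sumr_ge0 => i _; exact: sum_sqr_ge0.
  by apply: eq_bigr => i _; apply: eq_bigr => j _; rewrite mxE.
have WE2 x : (laplacian eta x - dot (grad eta x) x) ^+ 2 = gauss_div u H x ^+ 2.
  by rewrite WE.
have jeta2 := Lfun2_integrable_sqr eta_L2.
have := Lfun2_integrable_sqr grad_L2; rewrite (funext GE) => jG.
have := Lfun2_integrable_sqr hess_L2; rewrite (funext HE) => jHS.
have := Lfun2_integrable_sqr OU_L2; rewrite (funext WE2) => jW.
have [AHG GHS lower varG] :=
  even_gauss_inequalities Ceta Cu eta_even jeta2 jG jHS jW.
by split; [|split]; lra.
Qed.
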